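(* Let $G$ be a nonelementary hyperbolic group and let $\mu$ be an admissible measure on $G$. Then for every $\varepsilon\in(0,1)$ there exists $r>0$ such that the property $\mathsf{TA}_{\varepsilon,r}$ holds.
   Context: A probability measure $\mu$ on a group $G$ is admissible if it is symmetric ($\mu(g)=\mu(g^{-1})$), has finite support $\mathcal S=\operatorname{supp}\mu=\{g:\mu(g)>0\}$, and $\mathcal S$ generates $G$. Let $\langle\mathcal S\rangle$ be the free monoid on $\mathcal S$ (words, including the empty word), $\ell_\psi$ the length of a word $\psi$, and $\boldsymbol\pi:\langle\mathcal S\rangle\to G$ the evaluation homomorphism. The word norm is $|g|=\min\{\ell_\psi:\boldsymbol\pi(\psi)=g\}$ and the word distance between $x$ and $y$ is $|x^{-1}y|$. For $x,z\in G$, $[x,z]=\{y\in G:|x^{-1}y|+|y^{-1}z|=|x^{-1}z|\}$, and $B_{\leqslant r}(y)$ is the closed ball of radius $r$ centered at $y$ in the word distance. $\mathrm{Pth}(x,z)=\boldsymbol\pi^{-1}(x^{-1}z)$ is the set of paths from $x$ to $z$: a word $\psi=s_1\dots s_n$ in it is the path visiting the vertices $x\boldsymbol\pi(s_1\cdots s_i)$, $0\leqslant i\leqslant n$; this set of vertices is $\mathrm{Im}\,\psi$. The weight of $\psi$ is $\mu_\psi=\prod_{i=1}^n\mu(s_i)$ (and $1$ for the empty word). The Green function is $\mathrm{Gr}_\mu(g)=\sum\{\mu_\psi:\psi\in\boldsymbol\pi^{-1}(g)\}$; it is finite for every $g$ since nonelementary hyperbolic groups are non-amenable, hence transient. $\mathbb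 P_{x,z}$ is the probability measure on $\mathrm{Pth}(x,z)$ with $\mathbb P_{x,z}\{\psi\}=\mu_\psi/\mathrm{Gr}_\mu(x^{-1}z)$. Property $\mathsf{TA}_{\varepsilon,r}$: for every $x,z\in G$ and every $y\in[x,z]$, $\mathbb P_{x,z}\{\psi\in\mathrm{Pth}(x,z):B_{\leqslant r}(y)\cap\mathrm{Im}\,\psi\neq\varnothing\}>1-\varepsilon$. *)

(* Defs.v *)
From HB Require Import structures.
From mathcomp Require Import all_boot all_order all_algebra.
From mathcomp Require Import all_classical all_reals.
From mathcomp Require Import ereal esum.
Set Implicit Arguments.
Unset Strict Implicit.
Unset Printing Implicit Defensive.
Import Order.TTheory GRing.Theory Num.Theory.
Local Open Scope classical_set_scope.
Local Open Scope ring_scope.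

(* groupType is the type of arbitrary, possibly infinite, groups; its operations
   are written in group_scope (%g). *)

Section Groups.
Variable G : groupType.
Implicit Types (S : set G) (w : seq G) (o x y z : G).

Definition subgroup_generated S : set G :=
  smallest [set H : set G | group_closed (mem H)] S.

Definition generates S : Prop := subgroup_generated S = setT.

Definition symmetric_set S : Prop := forall s, S s -> S (s^-1)%g.

(* The free monoid on S: finite sequences with all letters in S. *)
Definition words S : set (seq G) := [set w | {in w, forall s, S s}].

Definition word_eval w : G := \big[*%g/1%g]_(s <- w) s.

(* The minimum exists as soon as S is symmetric and generates G; the default
   value 0 is returned on elements that are not represented by any word. *)
Definition word_norm S x : nat :=
  let lengths := [set n | exists w, [/\ words S w, word_eval w = x & size w = n]]
  in get [set n | lengths n /\ forall m, lengths m -> (n <= m)%N].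

Definition word_dist S x y : nat := word_norm S (x^-1 * y)%g.

Definition word_interval S x z : set G :=
  [set y | (word_dist S x y + word_dist S y z)%N = word_dist S x z].

Definition word_ball (R : realType) S (r : R) y : set G :=
  [set g | (word_dist S y g)%:R <= r].

Definition paths S x z : set (seq G) :=
  [set w | words S w /\ word_eval w = (x^-1 * z)%g].

Definition path_vertices x w : set G :=
  [set (x * word_eval (take i w))%g | i in [set i | (i <= size w)%N]].

(* Word distances are integers, so Gromov products lie in rat, and restricting
   the hyperbolicity constant below to rat loses nothing. *)
Definition gromov_product S o x y : rat :=
  ((word_dist S x o)%:R + (word_dist S y o)%:R - (word_dist S x y)%:R) / 2%:R.

Definition gromov_hyperbolic S (delta : rat) : Prop :=
  forall o x y z : G,
    Num.min (gromov_product S o x y) (gromov_product S o y z) - delta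
      <= gromov_product S o x z.

End Groups.

Definition hyperbolic_group (G : groupType) : Prop :=
  exists S : set G, [/\ finite_set S, symmetric_set S, generates S &
    exists delta : rat, gromov_hyperbolic S delta].

(* Elementary = virtually cyclic, i.e. some cyclic subgroup (possibly trivial,
   which is the case of finite groups) has finitely many left cosets. *)
Definition elementary_group (G : groupType) : Prop :=
  exists a : G, finite_set
    [set [set (x * h)%g | h in subgroup_generated [set a]] | x in [set: G]].

Definition nonelementary_group (G : groupType) : Prop := ~ elementary_group G.

Section Walks.
Variables (R : realType) (G : groupType).
Implicit Types (mu : G -> R) (w : seq G) (x y z : G).

(* A probability measure on the discrete group G is given by its masses. *)
Definition probability_mass mu : Prop :=
  (forall g, 0 <= mu g) /\ (\esum_(g in [set: G]) (mu g)%:E)%E = 1%E.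

Definition supp mu : set G := [set g | 0 < mu g].

Record admissible mu : Prop := Admissible {
  admissible_probability : probability_mass mu;
  admissible_symmetric : forall g, mu g = mu (g^-1)%g;
  admissible_finite : finite_set (supp mu);
  admissible_generates : generates (supp mu)
}.

Definition weight mu w : R := \prod_(s <- w) mu s.

Definition Green mu (g : G) : \bar R :=
  (\esum_(w in [set w | words (supp mu) w /\ word_eval w = g]) (weight mu w)%:E)%E.

(* If the Green function were infinite, fine would return 0, every path would
   get mass 0, and TA would fail for every epsilon in (0,1). *)
Definition path_mass mu x z w : R := weight mu w / fine (Green mu (x^-1 * z)%g).

Definition path_prob mu x z (A : set (seq G)) : \bar R :=
  (\esum_(w in paths (supp mu) x z `&` A) (path_mass mu x z w)%:E)%E.

Definition TA mu (epsilon r : R) : Prop :=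
  forall x z y : G, word_interval (supp mu) x z y ->
    ((1 - epsilon)%:E <
      path_prob mu x z
        [set w | word_ball (supp mu) r y `&` path_vertices x w !=set0])%E.

End Walks.

(* Main.v *)
(* Let |.| be the word norm of a finite symmetric generating set S for which G
   is hyperbolic, and T the support of mu.

   Spectral gap. If (g|h) = 0 and |g| = |h| is large, then g,
   h or g^-1 h is an element a whose square is notably longer than a. As G is
   not virtually cyclic, some long element escapes the directions of a and a^-1,
   and the lengths |g f| grow on average over three long elements f in distinct
   directions. So q^|g| contracts on average for some q < 1, and the series
   of the q^|g| diverges; since the elements a^i h a^j with h bounded contribute
   a convergent series, some long d cannot be shortened by a on either side.
   Powers of a together with d give a finite symmetric family with a drift, hence
   by Schur's test a contraction of l^2(G). Comparing Dirichlet forms along words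
   transfers the gap to mu: the words of length n evaluating to a given element
   have total weight at most theta^n with theta < 1.

   Ancona-type argument. By hyperbolicity a path from u to v that avoids the ball
   of radius r around a point close to a geodesic from u to v is exponentially
   long in r, so such paths have total weight at most theta^(2^(r/D)), which beats
   the lower bound c^|u^-1 v| of the Green function as long as |u^-1 v| = O(r).
   For endpoints far from y, put balls of radius n 2^k at distance proportional
   to n 2^k from y on both sides along the geodesic. Cutting a path at its first
   visit to the left ball and its last visit to the right ball of scale k + 1,
   the previous estimate shows that it misses a ball of scale k with conditional
   probability at most eta 2^-(n 2^k); these bounds are summed over k. T-geodesics
   stay close to S-geodesics by the Morse lemma. *)
Require Import Defs.
From mathcomp Require Import all_boot all_order all_algebra.
From mathcomp Require Import all_classical all_reals.
From mathcomp Require Import ereal esum.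
From mathcomp Require Import zify lra.
Set Implicit Arguments.
Unset Strict Implicit.
Unset Printing Implicit Defensive.
Import Order.TTheory GRing.Theory Num.Theory.
Local Open Scope classical_set_scope.

(** * Word metrics *)

Section WordMetric.
Variables (G : groupType) (S : set G).
Implicit Types (w : seq G) (x y z g : G).
Local Notation norm := (word_norm S).
Local Notation dist := (word_dist S).

Lemma word_eval_cat w1 w2 :
  word_eval (w1 ++ w2) = (word_eval w1 * word_eval w2)%g.
Proof. exact: big_cat. Qed.

Lemma word_eval_cons g w : word_eval (g :: w) = (g * word_eval w)%g.
Proof. exact: big_cons. Qed.

Lemma word_eval_nil : word_eval [::] = (1 : G)%g.
Proof. exact: big_nil. Qed.

Lemma word_eval_seq1 g : word_eval [:: g] = g.
Proof. by rewrite word_eval_cons word_eval_nil mulg1. Qed.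

Lemma words_cat w1 w2 : words S (w1 ++ w2) <-> words S w1 /\ words S w2.
Proof.
split=> [h|[h1 h2] s]; last by rewrite mem_cat => /orP[/h1|/h2].
by split=> s sw; apply: h; rewrite mem_cat sw ?orbT.
Qed.

Lemma words_cons g w : words S (g :: w) <-> S g /\ words S w.
Proof.
split=> [h|[h1 h2] s]; last by rewrite in_cons => /orP[/eqP->|/h2].
by split=> [|s sw]; apply: h; rewrite in_cons ?eqxx // sw orbT.
Qed.

Lemma words_nil : words S [::].
Proof. by move=> s; rewrite in_nil. Qed.

Lemma words_take n w : words S w -> words S (take n w).
Proof. by rewrite -{1}(cat_take_drop n w) => /words_cat[]. Qed.

Lemma words_drop n w : words S w -> words S (drop n w).
Proof. by rewrite -{1}(cat_take_drop n w) => /words_cat[]. Qed.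

Hypotheses (symS : symmetric_set S) (genS : generates S).

Lemma words_rev_inv w : words S w ->
  words S (rev [seq (s^-1)%g | s <- w]) /\
  word_eval (rev [seq (s^-1)%g | s <- w]) = ((word_eval w)^-1)%g.
Proof.
elim: w => [_|s w IH /words_cons[Ss /IH[Ww Ew]]].
  by split; [exact: words_nil|rewrite /rev /= word_eval_nil invg1].
rewrite map_cons rev_cons -cats1 word_eval_cat word_eval_seq1 Ew.
rewrite word_eval_cons invgM; split => //; apply/words_cat; split => //.
by apply/words_cons; split; [exact: symS|exact: words_nil].
Qed.

Lemma word_exists x : exists2 w, words S w & word_eval w = x.
Proof.
have : subgroup_generated S x by rewrite genS.
move/(_ [set y | exists2 w, words S w & word_eval w = y]).
apply; split=> [|s Ss]; last first.
  exists [:: s]; last exact: word_eval_seq1.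
  by apply/words_cons; split => //; exact: words_nil.
split; first by rewrite in_setE; exists [::]; [exact: words_nil|exact: word_eval_nil].
move=> u v; rewrite !in_setE => -[wu Wu <-] [wv Wv <-].
have [W E] := words_rev_inv Wv.
exists (wu ++ rev [seq (s^-1)%g | s <- wv]).
  by apply/words_cat.
by rewrite word_eval_cat E.
Qed.

Lemma word_normP x :
  (exists w, [/\ words S w, word_eval w = x & size w = norm x]) /\
  (forall w, words S w -> word_eval w = x -> (norm x <= size w)%N).
Proof.
pose L := [set n | exists w, [/\ words S w, word_eval w = x & size w = n]].
pose P := [set n | L n /\ forall m, L m -> (n <= m)%N].
have exL : exists n, `[< L n >].
  have [w Ww Ew] := word_exists x.
  by exists (size w); apply/asboolP; exists w.
have PP : P (ex_minn exL).
  case: ex_minnP => m /asboolP Lm minm; split=> // k Lk.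
  by apply: minm; exact/asboolP.
have [Lx minx] : P (norm x) := getI PP.
by split=> // w Ww Ew; apply: minx; exists w.
Qed.

Lemma word_norm_le w : words S w -> (norm (word_eval w) <= size w)%N.
Proof. by move=> Ww; have [_] := word_normP (word_eval w); apply. Qed.

Lemma word_norm1 : norm 1%g = 0%N.
Proof.
by apply/eqP; rewrite -leqn0 -word_eval_nil; exact/(word_norm_le words_nil).
Qed.

Lemma word_normM x y : (norm (x * y)%g <= norm x + norm y)%N.
Proof.
have [[wx [Wx <- <-]] _] := word_normP x.
have [[wy [Wy <- <-]] _] := word_normP y.
by rewrite -word_eval_cat -size_cat word_norm_le //; apply/words_cat.
Qed.

Lemma word_normV x : norm (x^-1)%g = norm x.
Proof.
suff le y : (norm (y^-1)%g <= norm y)%N.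
  by apply/eqP; rewrite eqn_leq le /= -{1}(invgK x) le.
have [[w [Ww <- <-]] _] := word_normP y.
have [W <-] := words_rev_inv Ww.
by apply: (leq_trans (word_norm_le W)); rewrite size_rev size_map.
Qed.

Lemma word_norm_gen s : S s -> (norm s <= 1)%N.
Proof.
move=> Ss; rewrite -(word_eval_seq1 s) word_norm_le //.
by apply/words_cons; split => //; exact: words_nil.
Qed.

Lemma word_norm_split x k : (k <= norm x)%N ->
  exists p, norm p = k /\ norm (p^-1 * x)%g = (norm x - k)%N.
Proof.
move=> kx; have [[w [Ww Ew sw]] _] := word_normP x.
have Ex : x = (word_eval (take k w) * word_eval (drop k w))%g.
  by rewrite -word_eval_cat cat_take_drop.
have l1 := word_norm_le (words_take (n := k) Ww).
have l2 := word_norm_le (words_drop (n := k) Ww).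
have := word_normM (word_eval (take k w)) (word_eval (drop k w)).
rewrite size_take_min (minn_idPl _) in l1; last by rewrite sw.
rewrite size_drop in l2; rewrite -Ex => l3.
exists (word_eval (take k w)).
have -> : ((word_eval (take k w))^-1 * x)%g = word_eval (drop k w).
  by rewrite Ex mulKg.
by move: l1 l2 l3 kx; rewrite sw; lia.
Qed.

Lemma word_distxx x : dist x x = 0%N.
Proof. by rewrite /word_dist mulVg word_norm1. Qed.

Lemma word_distC x y : dist x y = dist y x.
Proof. by rewrite /word_dist -word_normV invgM invgK. Qed.

Lemma word_distD y x z : (dist x z <= dist x y + dist y z)%N.
Proof.
by rewrite /word_dist -{1}(mulgK y (x^-1)%g) -mulgA word_normM.
Qed.

Lemma word_dist1 x : dist 1%g x = norm x.
Proof. by rewrite /word_dist invg1 mul1g. Qed.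

Lemma word_dist_split x z k : (k <= dist x z)%N ->
  exists y, dist x y = k /\ dist y z = (dist x z - k)%N.
Proof.
move=> /word_norm_split[p [p1 p2]]; exists (x * p)%g.
by rewrite /word_dist mulKg p1 invgM -mulgA p2.
Qed.

Lemma finite_words n : finite_set S ->
  finite_set [set w | words S w /\ size w = n].
Proof.
move=> finS; elim: n => [|n IH].
  by apply: (sub_finite_set _ (finite_set1 [::])) => w [_ /size0nil].
apply: (sub_finite_set _ (finite_image2 cons finS IH)).
move=> [|s w] [] // /words_cons[Ss Ww] [sw].
by exists s => //; exists w.
Qed.

Lemma finite_norm_ball n : finite_set S -> finite_set [set x | (norm x <= n)%N].
Proof.
move=> finS; elim: n => [|n IH].
  apply: (sub_finite_set _ (finite_image (@word_eval G) (finite_words 0 finS))).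
  by move=> x; rewrite /= leqn0 => /eqP x0; have [[w [Ww Ew sw]] _] := word_normP x;
    exists w => //; rewrite sw x0.
have := finite_image (@word_eval G) (finite_words n.+1 finS).
move=> /(conj IH); rewrite -finite_setU; apply: sub_finite_set => x /=.
rewrite leq_eqVlt => /orP[/eqP xn|]; last by left.
by right; have [[w [Ww Ew sw]] _] := word_normP x; exists w => //; rewrite sw xn.
Qed.

End WordMetric.

Lemma finite_set_nat_bound (T : choiceType) (A : set T) (f : T -> nat) :
  finite_set A -> exists M, forall t, A t -> (f t <= M)%N.
Proof.
move=> /finite_seqP[s ->]; exists (\max_(t <- s) f t)%N => t ts.
exact: leq_bigmax_seq.
Qed.

Lemma word_norm_lipschitz (G : groupType) (S T : set G) :
  symmetric_set S -> generates S -> symmetric_set T -> generates T ->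
  finite_set T -> exists lam : nat, forall x, (word_norm S x <= lam * word_norm T x)%N.
Proof.
move=> symS genS symT genT finT.
have [M HM] := finite_set_nat_bound (word_norm S) finT.
exists M => x; have [[w [Ww <- <-]] _] := word_normP symT genT x.
elim: w Ww => [_|s w IH /words_cons[Ts Ww]].
  by rewrite word_eval_nil word_norm1.
rewrite word_eval_cons; apply: (leq_trans (word_normM symS genS _ _)) => /=.
by rewrite mulnS leq_add ?HM ?IH.
Qed.

(** * Gromov products and the Morse lemma *)

Lemma leq_affine_exp2 a b : exists n0, forall n, (n0 <= n)%N -> (a + b * n <= 2 ^ n)%N.
Proof.
have sq n : (4 <= n)%N -> (n * n <= 2 ^ n)%N.
  elim: n => // n IH; rewrite leq_eqVlt => /orP[/eqP <- //|n4].
  by rewrite expnS; have := IH n4; move: (2 ^ n)%N => m; nia.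
exists (a + b + 5)%N => n nn.
by apply: leq_trans (sq n _); [nia|lia].
Qed.

Section Gromov.
Variables (G : groupType) (S : set G).
Implicit Types (o x y z u v g : G).
Local Notation d := (word_dist S).

(* Twice the Gromov product, so that it is an integer; the subtraction does not
   truncate, by the triangle inequality. *)
Definition gp2 o x y := (d o x + d o y - d x y)%N.

(** [D] stands for twice the hyperbolicity constant, so that later uses of the four-point condition
    are integer linear arithmetic. *)
Definition hyp_const (D : nat) :=
  forall o x y z, (minn (gp2 o x y) (gp2 o y z) <= gp2 o x z + D)%N.

Hypotheses (symS : symmetric_set S) (genS : generates S).
Let dC := word_distC symS genS.
Let dD := word_distD symS genS.
Let dxx := word_distxx symS genS.

Lemma gp2C o x y : gp2 o x y = gp2 o y x.
Proof. by rewrite /gp2 (dC x y) addnC. Qed.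

Lemma gp2_add o x y : (gp2 o x y + d x y = d o x + d o y)%N.
Proof. by rewrite /gp2 subnK // (dC o x); exact: dD. Qed.

Lemma gp2E o x y :
  ((gp2 o x y)%:R / 2%:R = gromov_product S o x y :> rat)%R.
Proof.
rewrite /gromov_product; congr (_ / _)%R; rewrite (dC x o) (dC y o).
by rewrite -natrD -gp2_add natrD addrK.
Qed.

Lemma hyp_constE delta : gromov_hyperbolic S delta -> exists D, hyp_const D.
Proof.
move=> hyp; exists (Num.bound `|2%:R * delta|%R) => o x y z.
have := hyp o x y z; rewrite -!gp2E => h.
have b : (2 * delta < (Num.bound `|2 * delta|)%:R)%R.
  exact: le_lt_trans (ler_norm _) (archi_boundP (normr_ge0 _)).
rewrite geq_min -!(ler_nat rat) !natrD.
move: h; rewrite lerBlDr ge_min => /orP[] h; apply/orP; [left|right]; lra.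
Qed.

Variable D : nat.
Hypothesis hyp : hyp_const D.

Lemma hyp_cases o x y z :
  (gp2 o x y <= gp2 o x z + D)%N \/ (gp2 o y z <= gp2 o x z + D)%N.
Proof. by have := hyp o x y z; rewrite geq_min => /orP[]; [left|right]. Qed.

(** Bisection: each of the [k] halvings costs [D] by the four-point condition, and a single step
    outside the ball of radius [r] has product at least [2 * r - lam]. Thus a chain far from [o]
    whose endpoints have a small product at [o] is exponentially long. *)
Lemma gp2_path k (p : nat -> G) o r lam i l : (l <= 2 ^ k)%N ->
  (forall j, (i <= j <= i + l)%N -> (r <= d o (p j))%N) ->
  (forall j, (i <= j < i + l)%N -> (d (p j) (p j.+1) <= lam)%N) ->
  (2 * r <= gp2 o (p i) (p (i + l)) + lam + k * D)%N.
Proof.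
elim: k i l => [|k IH] i l.
  case: l => [_ far _|[|//] _ far near].
    have := far i; rewrite addn0 leqnn => /(_ isT).
    by have := gp2_add o (p i) (p i); rewrite dxx; lia.
  have := far i; have := far i.+1; have := near i; rewrite addn1.
  move=> /(_ ltac:(lia)) h1 /(_ ltac:(lia)) h2 /(_ ltac:(lia)) h3.
  by have := gp2_add o (p i) (p i.+1); lia.
rewrite expnS => lk far near.
pose l1 := (l %/ 2)%N.
have h1 := IH i l1 ltac:(lia) (fun j h => far j ltac:(lia)) (fun j h => near j ltac:(lia)).
have h2 := IH (i + l1)%N (l - l1)%N ltac:(lia) (fun j h => far j ltac:(lia)) (fun j h => near j ltac:(lia)).
rewrite (_ : i + l1 + (l - l1) = i + l)%N in h2; last by lia.
have [] := hyp_cases o (p i) (p (i + l1)%N) (p (i + l)%N); lia.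
Qed.

(** * Stability of quasi-geodesics *)

Section Morse.
Variable lam : nat.
Hypothesis lam1 : (1 <= lam)%N.

Definition quasi_geodesic n (p : nat -> G) :=
  forall i j, (i <= j <= n)%N ->
    (d (p i) (p j) <= lam * (j - i))%N /\ (j - i <= lam * d (p i) (p j))%N.

(** The detour met in [morse_near] has at most [6 * lam * m] steps. As [k] grows like the logarithm
    of [m], the loss [k * D] of [gp2_path] is eventually beaten by [2 * m]. *)
Lemma morse_scale : exists D0, forall m, (D0 <= m)%N ->
  exists k, (6 * lam * m <= 2 ^ k)%N /\ (lam + (k + 2) * D < 2 * m)%N.
Proof.
have [t0 ht0] := leq_affine_exp2 (lam + (6 * lam + 3) * D) D.
exists (2 ^ t0)%N => m m0.
have m1 : (0 < m)%N by apply: leq_trans m0; rewrite expn_gt0.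
have /andP[tl tr] := trunc_log_bounds (isT : (1 < 2)%N) m1.
set t := trunc_log 2 m in tl tr.
(* [2 ^ t.+1] exceeds [m] and [2 ^ (6 * lam)] exceeds [6 * lam]. *)
exists (t.+1 + 6 * lam)%N; split.
  rewrite expnD mulnC leq_mul //; first exact: ltnW.
  exact/ltnW/ltn_expl.
have tt0 : (t0 <= t)%N by rewrite trunc_log_max.
have := ht0 t tt0; rewrite (_ : (_ + 2) * D = (6 * lam + 3) * D + D * t)%N; last by nia.
by lia.
Qed.

(** Extremal argument: let [q] be a point of the interval whose distance [m] to the chain is
    largest. Points at distance [2 * m] from [q] on either side (or the endpoints) are within [m] of
    the chain, and the piece of chain between their neighbours is too short to go around the ball of
    radius [m] at [q], unless [m <= D0]. *)
Lemma morse_near : exists D0, forall n p, quasi_geodesic n p ->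
  forall q, (d (p 0%N) q + d q (p n) = d (p 0%N) (p n))%N ->
  exists2 i, (i <= n)%N & (d q (p i) <= D0)%N.
Proof.
have [D0 HD0] := morse_scale; exists D0 => n p qg.
set x := p 0%N; set z := p n.
pose I q := (d x q + d q z = d x z)%N.
pose P m := `[< exists q, I q /\ forall i, (i <= n)%N -> (m <= d q (p i))%N >].
have exP : exists m, P m.
  by exists 0%N; apply/asboolP; exists x; split=> //; rewrite /I dxx.
have bP m : P m -> (m <= d x z)%N.
  by move=> /asboolP[q [Iq /(_ 0%N isT)]]; move: Iq; rewrite /I -/x dC; lia.
case: (ex_maxnP exP bP) => m /asboolP[q [Iq far]] maxm.
have near q' : I q' -> exists2 i, (i <= n)%N & (d q' (p i) <= m)%N.
  move=> Iq'; apply: contrapT => no; have : P m.+1.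
    apply/asboolP; exists q'; split=> // i ni; rewrite ltnNge; apply/negP => le.
    by apply: no; exists i.
  by move=> /maxm; rewrite ltnn.
suff mD : (m <= D0)%N.
  by move=> q' /near[i ni le]; exists i => //; exact: leq_trans mD.
rewrite leqNgt; apply/negP => /ltnW/HD0[k [k1 k2]].
(* The point at distance 2m from q towards the endpoint e, or e itself. *)
have side e ie : (ie <= n)%N -> e = p ie ->
    (forall c, (d e c + d c q = d e q)%N -> I c) ->
    exists c j, [/\ (j <= n)%N, (d c q <= 2 * m)%N, (d c (p j) <= m)%N,
      (d e c + d c q = d e q)%N & (2 * m <= gp2 q c (p j))%N].
  move=> ien -> Ic; have [le|lt] := leqP (d (p ie) q) (2 * m).
    exists (p ie), ie; split; rewrite ?dxx //.
    by have := far ie ien; have := gp2_add q (p ie) (p ie); rewrite dxx; lia.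
  have [c [c1 c2]] := word_dist_split symS genS (x := p ie) (z := q)
    (k := d (p ie) q - 2 * m) ltac:(lia).
  have ec : (d (p ie) c + d c q = d (p ie) q)%N by lia.
  have [j jn cj] := near c (Ic c ec).
  exists c, j; split=> //; first by lia.
  by have := far j jn; have := gp2_add q c (p j); rewrite (dC q c); lia.
have Icx c : (d x c + d c q = d x q)%N -> I c.
  by move: Iq; rewrite /I; have := dD q c z; have := dD c x z; lia.
have Icz c : (d z c + d c q = d z q)%N -> I c.
  move: Iq; rewrite /I (dC z c) (dC z q) (dC c q).
  by have := dD q x c; have := dD c x z; lia.
have [cx [jx [jxn cx1 cx2 cx3 cx4]]] := side x 0%N isT erefl Icx.
have [cz [jz [jzn cz1 cz2 cz3 cz4]]] := side z n (leqnn n) erefl Icz.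
have cxz : gp2 q cx cz = 0%N.
  have := gp2_add q cx cz; have := dD cx x z; have := dD cz cx z.
  by move: Iq cx3 cz3; rewrite /I (dC z cz) (dC z q) (dC q cx) (dC q cz); lia.
(* [cx] and [cz] lie on opposite sides of [q], and each has a large product at [q] with its
   neighbour on the chain; replacing both points by their neighbours costs [D] each. *)
have gj : (gp2 q (p jx) (p jz) <= 2 * D)%N.
  have := hyp_cases q cx (p jx) cz; have := hyp_cases q (p jx) (p jz) cz.
  by rewrite cxz (gp2C q (p jz)); lia.
have dj : (d (p jx) (p jz) <= 6 * m)%N.
  have := dD cx (p jx) (p jz); have := dD q cx (p jz); have := dD cz q (p jz).
  by rewrite (dC (p jx) cx) (dC q cz); lia.
suff contra i j : (i <= j <= n)%N -> (gp2 q (p i) (p j) <= 2 * D)%N ->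
    (d (p i) (p j) <= 6 * m)%N -> False.
  have [le|le] := leqP jx jz; first by apply: (contra jx jz); rewrite ?le.
  by apply: (contra jz jx); rewrite 1?gp2C 1?dC // ltnW.
move=> ijn g6 d6; have [_ q2] := qg i j ijn.
have jik : (j - i <= 2 ^ k)%N.
  by apply: leq_trans k1; rewrite (mulnC 6) -mulnA; apply: leq_trans q2 _; rewrite leq_mul2l d6 orbT.
have := gp2_path (p := p) (o := q) (r := m) (lam := lam) (i := i) jik.
rewrite subnKC; last by lia.
move=> path; suff : (2 * m <= gp2 q (p i) (p j) + lam + k * D)%N by lia.
apply: path => l hl; first by apply: far; lia.
by have [+ _] := qg l l.+1 ltac:(lia); rewrite subSnn muln1.
Qed.

(** Connectedness argument: moving from [x] to [z] by unit steps, the index of a nearby chain point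
    crosses [i]; at the crossing two such indices surround [i] and are boundedly far apart, so [p i]
    is near the interval. The doubled product at [p i] is at most twice that distance. *)
Lemma morse : exists C0, forall n p, quasi_geodesic n p ->
  forall i, (i <= n)%N -> (gp2 (p i) (p 0%N) (p n) <= C0)%N.
Proof.
have [D0 HD0] := morse_near.
exists (2 * (D0 + lam * (lam * (2 * D0 + 1))))%N => n p qg i ni.
set x := p 0%N; set z := p n.
pose L q := exists2 l, (l <= i)%N & (d q (p l) <= D0)%N.
pose M q := exists l, [/\ (i <= l)%N, (l <= n)%N & (d q (p l) <= D0)%N].
have near q q' : L q -> M q' -> (d q q' <= 1)%N -> (d (p i) q <= D0 + lam * (lam * (2 * D0 + 1)))%N.
  move=> [l li ql] [l' [il ln ql']] qq.
  have [_ a1] := qg l l' ltac:(lia); have [a2 _] := qg l i ltac:(lia).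
  have := dD q (p l) (p l'); have := dD q' q (p l'); rewrite (dC (p l) q) => b1 b2.
  have := dD (p l) (p i) q; rewrite (dC (p l) q) (dC (p i) (p l)) => b3.
  apply: (leq_trans b3); rewrite addnC leq_add //.
  apply: (leq_trans a2); rewrite leq_mul2l; apply/orP; right.
  apply: (@leq_trans (lam * d (p l) (p l'))); first by lia.
  by rewrite leq_mul2l; apply/orP; right; lia.
suff [q Hq] : exists q, (d (p i) q <= D0 + lam * (lam * (2 * D0 + 1)))%N /\ (d x q + d q z = d x z)%N.
  have := gp2_add (p i) x z; have := dD q (p i) x; have := dD q (p i) z.
  by rewrite (dC q x); lia.
have main k : (k <= d x z)%N -> (exists q, (d (p i) q <= D0 + lam * (lam * (2 * D0 + 1)))%N /\ (d x q + d q z = d x z)%N) \/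
    exists q, [/\ L q, d x q = k & d q z = (d x z - k)%N].
  elim: k => [_|k IH kz].
    right; exists x; rewrite dxx subn0; split=> //.
    by exists 0%N => //; rewrite dxx.
  have [|[q [Lq xq qz]]] := IH (ltnW kz); first by left.
  have [q' [q1 q2]] := word_dist_split symS genS (x := q) (z := z) (k := 1) ltac:(lia).
  have xq' : d x q' = k.+1 by have := dD q x q'; have := dD q' x z; lia.
  have [l ln ql] : exists2 l, (l <= n)%N & (d q' (p l) <= D0)%N.
    by apply: (HD0 n p qg); rewrite -/x -/z; lia.
  have [li|il] := leqP l i.
    by right; exists q'; split; [exists l|exact: xq'|lia].
  left; exists q; split; last by lia.
  by apply: (near q q') => //; [exists l; split=> //; exact: ltnW|rewrite q1].
have [//|[q [Lq xq qz]]] := main _ (leqnn (d x z)).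
exists q; split; last by lia.
have zz : d q z = 0%N by lia.
apply: (near q z) => //; last by rewrite zz.
by exists n; split=> //; rewrite dxx.
Qed.

End Morse.
End Gromov.

(** * Elements with a drift *)

(* The product, inverse and unit of a group can be elaborated through different
   canonical inheritance paths, which arithmetic tactics see as distinct. *)
Ltac group_paths G :=
  repeat match goal with
  | |- context [@monoid.mul ?M ?x ?y] =>
    lazymatch M with monoid_Group__to__monoid_Magma _ => fail
    | _ => change (@monoid.mul M x y) with (@monoid.mul G x y) end
  | |- context [@monoid.inv ?M ?x] =>
    lazymatch M with monoid_Group__to__monoid_BaseGroup _ => fail
    | _ => change (@monoid.inv M x) with (@monoid.inv G x) end
  | H : context [@monoid.mul ?M ?x ?y] |- _ =>
    lazymatch M with monoid_Group__to__monoid_Magma _ => fail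
    | _ => change (@monoid.mul M x y) with (@monoid.mul G x y) in H end
  | H : context [@monoid.inv ?M ?x] |- _ =>
    lazymatch M with monoid_Group__to__monoid_BaseGroup _ => fail
    | _ => change (@monoid.inv M x) with (@monoid.inv G x) in H end
  end.

Lemma nonelementary_infinite (G : groupType) :
  nonelementary_group G -> ~ finite_set [set: G].
Proof. by move=> ne fin; apply: ne; exists 1%g; exact: finite_image. Qed.

Section Loxodromic.
Variables (G : groupType) (S : set G) (D : nat).
Hypotheses (symS : symmetric_set S) (genS : generates S) (finS : finite_set S).
Hypothesis hyp : hyp_const S D.
Implicit Types (a c f g h x y z : G).
Local Notation norm := (word_norm S).
Local Ltac glia := group_paths G; lia.
Let nM := word_normM symS genS.
Let nV := word_normV symS genS.

(** By [norm_mul_ip], the value at [x^-1] and [y] is the length lost to cancellation in the product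
    of [x] and [y]. *)
Definition ip x y := gp2 S 1%g x y.

Lemma ip_add x y : (ip x y + norm (x^-1 * y)%g = norm x + norm y)%N.
Proof. by rewrite -[norm (_^-1 * _)%g]/(word_dist S x y) gp2_add // !word_dist1. Qed.

Lemma ipC x y : ip x y = ip y x.
Proof. exact: gp2C. Qed.

Lemma norm_mul_ip x y : (norm (x * y)%g + ip (x^-1)%g y = norm x + norm y)%N.
Proof. by have := ip_add (x^-1)%g y; rewrite nV invgK; glia. Qed.

Lemma ip_cases x y z : (ip x y <= ip x z + D)%N \/ (ip y z <= ip x z + D)%N.
Proof. exact: hyp_cases. Qed.

Lemma ip_le x y : (ip x y <= 2 * norm x)%N.
Proof.
have := ip_add x y; have := nM x (x^-1 * y)%g; rewrite mulVKg; glia.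
Qed.

(** A sequence rather than a set, so that repeated entries act as weights; the gain is uniform in
    [g]. *)
Definition drift (F : seq G) :=
  forall g, (size F * norm g + 1 <= \sum_(f <- F) norm (g * f)%g)%N.

(* A group element can be cancelled substantially by at most one of three
   long elements pointing in different directions. *)
Lemma drift3 K f1 f2 f3 :
  norm f2 = norm f1 -> norm f3 = norm f1 -> (2 * K + 2 * D < norm f1)%N ->
  (ip f1 f2 <= K)%N -> (ip f1 f3 <= K)%N -> (ip f2 f3 <= K)%N ->
  drift [:: f1; f2; f3].
Proof.
move=> n2 n3 nK i12 i13 i23 g; rewrite !big_cons big_nil /=.
have := norm_mul_ip g f1; have := norm_mul_ip g f2; have := norm_mul_ip g f3.
have := ip_le f1 (g^-1)%g; have := ip_le f2 (g^-1)%g; have := ip_le f3 (g^-1)%g.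
have := ip_cases f1 (g^-1)%g f2; have := ip_cases f1 (g^-1)%g f3.
have := ip_cases f2 (g^-1)%g f3.
rewrite (ipC f1 (g^-1)%g) (ipC f2 (g^-1)%g) (ipC f3 (g^-1)%g).
glia.
Qed.

(* The pairs {c, c^-1} and {d, d^-1} point in different directions, and so do
   c and c^-1, but d and d^-1 may share theirs: hence c has weight two. *)
Lemma drift6 K c d :
  (2 * K + 2 * D < norm d <= norm c)%N -> (ip c c^-1%g <= K)%N ->
  (ip c d <= K)%N -> (ip c d^-1%g <= K)%N ->
  (ip c^-1%g d <= K)%N -> (ip c^-1%g d^-1%g <= K)%N ->
  drift [:: c; c; c^-1; c^-1; d; d^-1]%g.
Proof.
move=> nK i1 i2 i3 i4 i5 g; rewrite !big_cons big_nil /=.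
have := norm_mul_ip g c; have := norm_mul_ip g (c^-1)%g.
have := norm_mul_ip g d; have := norm_mul_ip g (d^-1)%g.
have := ip_le c (g^-1)%g; have := ip_le (c^-1)%g (g^-1)%g.
have := ip_le d (g^-1)%g; have := ip_le (d^-1)%g (g^-1)%g.
have := ip_cases c (g^-1)%g (c^-1)%g; have := ip_cases c (g^-1)%g d.
have := ip_cases c (g^-1)%g (d^-1)%g; have := ip_cases (c^-1)%g (g^-1)%g d.
have := ip_cases (c^-1)%g (g^-1)%g (d^-1)%g.
rewrite (ipC c (g^-1)%g) (ipC (c^-1)%g (g^-1)%g) (ipC d (g^-1)%g).
rewrite (ipC (d^-1)%g (g^-1)%g) !nV.
glia.
Qed.

(* Equivalently, |a^2| exceeds |a| by 4 D + 4; this gap persists under squaring. *)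
Definition lox a := (ip a (a^-1)%g + (4 * D + 4) <= norm a)%N.

Lemma loxV a : lox a -> lox (a^-1)%g.
Proof. by rewrite /lox invgK ipC nV. Qed.

Lemma norm_sqr a : (norm (a * a)%g + ip a (a^-1)%g = 2 * norm a)%N.
Proof. by have := norm_mul_ip a a; rewrite ipC; glia. Qed.

Lemma ip_sqr a : ip (a * a)%g a = norm (a * a)%g.
Proof.
by have := ip_add a (a * a)%g; rewrite mulKg ipC; glia.
Qed.

(** The square keeps the direction of [a], so the four-point condition raises the product with the
    inverse by at most [2 * D], whereas the norm grows by at least [4 * D + 4]. *)
Lemma lox_sqr a : lox a -> lox (a * a)%g.
Proof.
rewrite /lox => la; have := norm_sqr a; have := ip_sqr a; have := ip_sqr (a^-1)%g.
rewrite -invgM nV.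
have := ip_cases a (a * a)%g (a^-1)%g.
have := ip_cases (a * a)%g ((a * a)^-1)%g (a^-1)%g.
by rewrite (ipC a (a * a)%g); glia.
Qed.

(** Iterated squaring, [k] being [2 ^ n]. The exponent is chosen before [a], so that one [k] serves
    both [a] and its inverse. *)
Lemma lox_pow n : exists k, forall a, lox a ->
  (norm a + n <= norm (a ^+ k)%g)%N /\ (norm a + 3 * D + 4 <= ip (a ^+ k)%g a)%N.
Proof.
elim: n => [|n [k IH]].
  exists 1%N => a la; rewrite expg1 addn0; split=> //.
  by move: la; rewrite /lox; have := ip_add a a; rewrite mulVg (word_norm1 symS genS); glia.
exists (2 * k)%N => a la; have [] := IH _ (lox_sqr la).
rewrite expgnA expg2; set b := (_ ^+ k)%g => h1 h2.
move: la; rewrite /lox; have := norm_sqr a; have := ip_sqr a.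
by have := ip_cases b (a * a)%g a; glia.
Qed.

Lemma exists_norm_ge n : ~ finite_set [set: G] -> exists x, (n <= norm x)%N.
Proof.
move=> inf; apply: contrapT => no; apply: inf.
apply: sub_finite_set (finite_norm_ball symS genS n finS) => x _ /=.
by rewrite leqNgt; apply/negP => nx; apply: no; exists x; exact: ltnW.
Qed.

Lemma exists_lox : ~ finite_set [set: G] -> exists a, lox a.
Proof.
(* If [g] of norm [M] fails [lox], then [ip g g^-1 > 2 * D], and likewise for [h]. This is enough
   for four uses of the four-point condition to turn [ip g h = 0] into [ip p p^-1 <= 4 * D]. *)
move=> inf; pose M := (6 * D + 5)%N.
have [w wM] := exists_norm_ge (2 * M) inf.
have [p [pM _]] := word_norm_split symS genS wM.
have [r [rM sM]] : exists r, norm r = M /\ norm (r^-1 * p)%g = M.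
  have [r [r1 r2]] := word_norm_split symS genS (x := p) (k := M) ltac:(lia).
  by exists r; split=> //; glia.
pose g := (r^-1)%g; pose h := (r^-1 * p)%g.
have gM : norm g = M by rewrite nV.
have gh : (g^-1 * h = p)%g by rewrite invgK mulVKg.
have hM : norm h = M by [].
clearbody g h; clear r rM sM.
have gh0 : ip g h = 0%N by have := ip_add g h; rewrite gh; glia.
have [lg|ng] := leqP (ip g (g^-1)%g + (4 * D + 4)) (norm g); first by exists g.
have [lh|nh] := leqP (ip h (h^-1)%g + (4 * D + 4)) (norm h); first by exists h.
exists p; rewrite /lox.
have pg : ip p (g^-1)%g = (2 * M)%N.
  have := ip_add (g^-1)%g p; rewrite invgK nV -gh mulVKg ipC gh; glia.
have ph : ip (p^-1)%g (h^-1)%g = (2 * M)%N.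
  by have := ip_add (p^-1)%g (h^-1)%g; rewrite invgK !nV -gh mulgK nV gh; glia.
have := ip_cases g (g^-1)%g h; have := ip_cases (g^-1)%g (h^-1)%g h.
have := ip_cases (g^-1)%g p (h^-1)%g; have := ip_cases p (p^-1)%g (h^-1)%g.
by move: ng nh pg ph; rewrite (ipC (h^-1)%g h) (ipC (g^-1)%g p) gM hM gh0 /M; glia.
Qed.

Lemma generated_cosetM a x :
  [set (x * a * h)%g | h in subgroup_generated [set a]] =
  [set (x * h)%g | h in subgroup_generated [set a]].
Proof.
have mulP u v : subgroup_generated [set a] u -> subgroup_generated [set a] v ->
    subgroup_generated [set a] (u * v)%g.
  move=> Hu Hv H HH; have [/group_closedM HM _] := HH.
  by rewrite -in_setE HM // in_setE; [exact: Hu|exact: Hv].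
have invP u : subgroup_generated [set a] u -> subgroup_generated [set a] (u^-1)%g.
  move=> Hu H HH; have [/group_closedV HV _] := HH.
  by rewrite -in_setE HV // in_setE; exact: Hu.
have aP : subgroup_generated [set a] a by move=> H [_]; apply.
apply/seteqP; split=> _ [h Hh <-].
  by exists (a * h)%g; [exact: mulP|rewrite mulgA].
by exists (a^-1 * h)%g; [exact: mulP (invP _ aP) Hh|rewrite -mulgA mulVKg].
Qed.

(** Otherwise every long [x] is shortened by right multiplication by [a] or [a^-1], which preserves
    the coset of [x]; all cosets would then meet a finite ball. Inversion exchanges left and right
    multiplication. *)
Lemma nonelementary_escape a n : nonelementary_group G ->
  exists g, [/\ (n <= norm g)%N, (norm g <= norm (a * g)%g)%N &
    (norm g <= norm (a^-1 * g)%g)%N].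
Proof.
move=> ne; apply: contrapT => no; apply: ne; exists a.
pose cs x := [set (x * h)%g | h in subgroup_generated [set a]].
apply: sub_finite_set (finite_image cs (finite_norm_ball symS genS n finS)).
move=> _ [x _ <-]; rewrite -/(cs x).
have [k] := ubnP (norm x); elim: k x => // k IH x /ltnSE xk.
have [xn|nx] := leqP (norm x) n; first by exists x.
have [lt|ge1] := ltnP (norm (x * a)%g) (norm x).
  by rewrite /cs -generated_cosetM; apply: IH; glia.
have [lt|ge2] := ltnP (norm (x * a^-1)%g) (norm x).
  have -> : cs x = cs (x * a^-1)%g by rewrite /cs -[RHS]generated_cosetM mulgVK.
  by apply: IH; glia.
exfalso; apply: no; exists (x^-1)%g; rewrite nV -[norm (a * _)%g]nV.
by rewrite -[norm (a^-1 * _)%g]nV !invgM !invgK; split=> //; exact: ltnW.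
Qed.

(** If [a^-1] does not shorten [g], then [ip a g <= norm a]. Since [c] agrees with [a] beyond that
    length, the four-point condition passes the bound on to [c]. *)
Lemma lox_pow_ip a c g : lox a -> (norm a + 3 * D + 4 <= ip c a)%N ->
  (norm g <= norm (a^-1 * g)%g)%N -> (ip c g <= norm a + 2 * D)%N.
Proof.
by move=> la ca ag; have := ip_add a g; have := ip_cases a c g; rewrite (ipC a c); glia.
Qed.

Lemma lox_pow_ipV a c : lox a -> (norm a + 3 * D + 4 <= ip c a)%N ->
  (norm a + 3 * D + 4 <= ip (c^-1)%g (a^-1)%g)%N -> (ip c (c^-1)%g <= norm a + 2 * D)%N.
Proof.
rewrite /lox => la ca ca'; have := ip_cases a c (a^-1)%g; have := ip_cases c (c^-1)%g (a^-1)%g.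
by rewrite (ipC a c); glia.
Qed.

Lemma ip_prefix x y p : (norm p + norm (p^-1 * y)%g = norm y)%N ->
  (ip x p <= ip x y)%N.
Proof.
move=> py; have := ip_add x p; have := ip_add x y.
have := nM (x^-1 * p)%g (p^-1 * y)%g; rewrite mulgA mulgK; glia.
Qed.

Lemma nonelementary_drift : nonelementary_group G -> exists F, drift F /\ F != [::].
Proof.
move=> ne; have [a la] := exists_lox (nonelementary_infinite ne).
have [k powk] := lox_pow (2 * (norm a + 2 * D) + 2 * D).+1.
have [n1 ca] := powk a la; have [_ ca'] := powk _ (loxV la).
set c := (a ^+ k)%g in n1 ca; rewrite expVgn -/c nV in ca'.
have [g [gc ag1 ag2]] := nonelementary_escape a (norm c) ne.
(* [drift3] asks for equal norms, so [g] is cut to a prefix of the norm of [c]; by [ip_prefix] this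
   does not increase the products. *)
have [p [p1 p2]] := word_norm_split symS genS gc.
exists [:: c; c^-1; p]%g; split=> //.
apply: (@drift3 (norm a + 2 * D)%N) => //; first by glia.
- exact: lox_pow_ipV la ca ca'.
- apply: (leq_trans (@ip_prefix c g p _)); first by glia.
  exact: lox_pow_ip la ca ag2.
- apply: (leq_trans (@ip_prefix (c^-1)%g g p _)); first by glia.
  by have := @lox_pow_ip (a^-1)%g (c^-1)%g g (loxV la); rewrite nV invgK; apply.
Qed.

(** Greedy shortening: each factor removed from either side strictly decreases the norm, which pays
    for one unit of the exponents. Powers of [a] and of [a^-1] are collected separately because
    exponents are naturals. *)
Lemma double_coset_reduce a n :
  (forall g, (n <= norm g)%N -> [\/ (norm (a * g)%g < norm g)%N,
     (norm (a^-1 * g)%g < norm g)%N, (norm (g * a)%g < norm g)%N |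
     (norm (g * a^-1)%g < norm g)%N]) ->
  forall g, exists (h : G) (i j k l : nat), [/\ (norm h < n)%N,
    (i + j + k + l <= norm g)%N & g = (a ^+ i * a^-1 ^+ j * h * a ^+ k * a^-1 ^+ l)%g].
Proof.
move=> red g; have [m] := ubnP (norm g); elim: m g => // m IH g /ltnSE gm.
have [gn|/red[] lt] := ltnP (norm g) n.
- by exists g, 0%N, 0%N, 0%N, 0%N; split=> //; rewrite !expg0 !mulg1 !mul1g.
- have [h [i [j [k [l [hn le E]]]]]] := IH (a * g)%g ltac:(lia).
  exists h, i, j.+1, k, l; split=> //; first by glia.
  rewrite -[g](mulKg a) E !mulgA expgS !mulgA.
  by do 4 congr (_ * _)%g; apply/commuteX/commute_sym/commuteV.
- have [h [i [j [k [l [hn le E]]]]]] := IH (a^-1 * g)%g ltac:(lia).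
  exists h, i.+1, j, k, l; split=> //; first by glia.
  by rewrite -[g](mulVKg a) E !mulgA expgS.
- have [h [i [j [k [l [hn le E]]]]]] := IH (g * a)%g ltac:(lia).
  exists h, i, j, k, l.+1; split=> //; first by glia.
  by rewrite -[g](mulgK a) E expgSr !mulgA.
- have [h [i [j [k [l [hn le E]]]]]] := IH (g * a^-1)%g ltac:(lia).
  exists h, i, j, k.+1, l; split=> //; first by glia.
  rewrite -[g](mulgVK a) E expgSr -!mulgA; do 4 congr (_ * _)%g.
  by apply/commute_sym/commuteX/commuteV.
Qed.

End Loxodromic.

Local Open Scope ring_scope.

(** * From drift to contraction *)

Section Esum.
Context {R : realType}.

Lemma esum_ub (T : choiceType) (A : set T) (a : T -> R) (M : R) :
  (forall s : seq T, uniq s -> (forall x, x \in s -> A x) -> \sum_(x <- s) a x <= M) ->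
  (\esum_(x in A) (a x)%:E <= M%:E)%E.
Proof.
move=> h; apply: ub_ereal_sup => _ [F [finF FA] <-].
rewrite fsbig_finite // sumEFin lee_fin; apply: h => // x.
by rewrite in_fset_set // inE => /FA.
Qed.

Lemma esum_mulr_le (T : choiceType) (A : set T) (a : T -> \bar R) (c : \bar R) :
  (0 <= c)%E -> (forall x, A x -> 0 <= a x)%E ->
  (\esum_(x in A) (a x * c) <= (\esum_(x in A) a x) * c)%E.
Proof.
move=> c0 a0; apply: ub_ereal_sup => _ [F [finF FA] <-].
have -> : (\sum_(x \in F) (a x * c) = (\sum_(x \in F) a x) * c)%E.
  rewrite !fsbig_finite // big_seq [in RHS]big_seq ge0_sume_distrl // => x.
  by rewrite in_fset_set // inE => /FA/a0.
by apply: lee_wpmul2r => //; apply: ereal_sup_ubound; exists F.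
Qed.

Lemma esum_setX_le (T U : choiceType) (A : set T) (B : set U)
    (f : T -> \bar R) (g : U -> \bar R) :
  (forall x, 0 <= f x)%E -> (forall y, 0 <= g y)%E ->
  (\esum_(x in A `*` B) (f x.1 * g x.2) <= (\esum_(x in A) f x) * \esum_(y in B) g y)%E.
Proof.
move=> f0 g0; have -> : A `*` B = A `*`` (fun=> B) by [].
rewrite -(@esum_esum R T U A (fun=> B) (fun x y => (f x * g y)%E)); last first.
  by move=> x y _ _; exact: mule_ge0.
apply: le_trans (esum_mulr_le _ _) => //; last exact: esum_ge0.
apply: le_esum => x _; rewrite muleC.
under eq_esum do rewrite muleC.
exact: esum_mulr_le.
Qed.

Lemma esum_geometric_le (q : R) : 0 < q < 1 ->
  (\esum_(n in [set: nat]) (q ^+ n)%:E <= ((1 - q)^-1)%:E)%E.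
Proof.
move=> /andP[q0 q1]; apply: esum_ub => s us _.
have q1' : 0 < 1 - q by rewrite subr_gt0.
apply: (@le_trans _ _ (\sum_(n < (\max_(k <- s) k).+1) q ^+ n)).
  rewrite -(big_mkord predT (fun n => q ^+ n)) /=.
  rewrite [leRHS](bigID (mem s)) /= -[leLHS]addr0 lerD //; last first.
    by apply: sumr_ge0 => n _; rewrite exprn_ge0 // ltW.
  rewrite -[leRHS]big_filter le_eqVlt; apply/orP; left; apply/eqP.
  apply: perm_big; apply: uniq_perm => //; first by rewrite filter_uniq ?iota_uniq.
  move=> n; rewrite mem_filter mem_index_iota /= ltnS.
  by case: (boolP (n \in s)) => //= ns; rewrite leq_bigmax_seq.
rewrite -[leRHS]mul1r ler_pdivlMr // mulrC -[q in 1 - q](@mulr1).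
have -> : (1 - q * 1) * \sum_(n < (\max_(k <- s) k).+1) q ^+ n =
    1 - q ^+ (\max_(k <- s) k).+1.
  by rewrite mulr1 -opprB mulNr -subrX1 opprB.
by rewrite gerBl exprn_ge0 // ltW.
Qed.

End Esum.

Section Contraction.
Variables (R : realType) (G : groupType) (S : set G).
Hypotheses (symS : symmetric_set S) (genS : generates S).
Local Notation norm := (word_norm S).
Implicit Types (F : seq G) (f g h : G).

(** Second-order expansion in [t] of a power of [(1 + t)^-1] with integer exponent [m - n] in
    [[-M, M]]. The form [1 + t] of the base reduces it to Bernoulli-type inequalities. *)
Lemma inv1D_expr_le (t M : R) (m n : nat) : 0 <= t -> M * t <= 1 / 2%:R ->
  m%:R <= n%:R + M -> n%:R <= m%:R + M ->
  ((1 + t)^-1) ^+ m <= ((1 + t)^-1) ^+ n * (1 - (m%:R - n%:R) * t + 2%:R * M ^+ 2 * t ^+ 2).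
Proof.
move=> t0 Mt mn nm; set q := (1 + t)^-1.
have t1 : 0 < 1 + t by lra.
have q0 : 0 < q by rewrite invr_gt0.
have q0' := ltW q0.
have [le|/ltnW le] := leqP n m.
- rewrite -natrB // -{1}(subnKC le) exprD ler_pM2l ?exprn_gt0 //.
  set s := (m - n)%N; have sM : s%:R <= M by rewrite natrB //; lra.
  have s0 : 0 <= s%:R :> R by rewrite ler0n.
  have b : 1 + s%:R * t <= (1 + t) ^+ s.
    elim: (s) => [|k IH]; first by rewrite mul0r addr0 expr0.
    rewrite exprS; apply: (@le_trans _ _ ((1 + t) * (1 + k%:R * t))).
      rewrite -natr1; have : 0 <= k%:R :> R by rewrite ler0n.
      nra.
    by rewrite ler_pM2l.
  have st : 0 <= s%:R * t by rewrite mulr_ge0.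
  rewrite exprVn; apply: (@le_trans _ _ ((1 + s%:R * t)^-1)).
    by rewrite lef_pV2 // posrE; lra.
  rewrite -[leLHS]mul1r ler_pdivrMr; last by lra.
  have : (s%:R * t) ^+ 2 <= M ^+ 2 * t ^+ 2.
    by rewrite exprMn ler_wpM2r ?exprn_ge0 // lerXn2r ?nnegrE //; lra.
  move: st; set y := s%:R * t; set z := M ^+ 2 * t ^+ 2.
  rewrite (_ : 2%:R * M ^+ 2 * t ^+ 2 = 2 * z); last by rewrite /z mulrA.
  move: y z => y z y0 yz; nra.
- have -> : q ^+ n = q ^+ m * q ^+ (n - m) by rewrite -exprD subnKC.
  rewrite -(opprB n%:R) -natrB // -mulrA ler_peMr ?exprn_ge0 //.
  set s := (n - m)%N; have sM : s%:R <= M by rewrite natrB //; lra.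
  have b k : (1 + t) ^+ k * (1 - k%:R * t) <= 1.
    elim: k => [|k IH]; first by rewrite mul0r subr0 expr0 mulr1.
    apply: le_trans IH; rewrite exprSr -mulrA ler_pM2l ?exprn_gt0 //.
    rewrite -natr1; have : 0 <= k%:R :> R by rewrite ler0n.
    nra.
  have s0 : 0 <= s%:R :> R by rewrite ler0n.
  have st : 0 <= s%:R * t by rewrite mulr_ge0.
  have st1 : s%:R * t <= 1 / 2 by apply: le_trans Mt; rewrite ler_wpM2r.
  have bs := b s; rewrite exprVn mulrC ler_pdivlMr ?exprn_gt0 // mul1r.
  have : (s%:R * t) ^+ 2 <= M ^+ 2 * t ^+ 2.
    by rewrite exprMn ler_wpM2r ?exprn_ge0 // lerXn2r ?nnegrE //; lra.
  rewrite (_ : 2%:R * M ^+ 2 * t ^+ 2 = 2 * (M ^+ 2 * t ^+ 2)); last by rewrite mulrA.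
  move: st st1 bs; rewrite mulNr opprK; set y := s%:R * t; set z := M ^+ 2 * t ^+ 2.
  move: ((1 + t) ^+ s) y z => e y z y0 y1 ey yz.
  by nra.
Qed.

Lemma drift_contract F : drift S F -> F != [::] ->
  exists q rho : R, [/\ 0 < q < 1, 0 <= rho < 1 & forall g,
    \sum_(f <- F) q ^+ norm (g * f)%g <= rho * (size F)%:R * q ^+ norm g].
Proof.
move=> dF F0; pose M : R := (\max_(f <- F) norm f)%N%:R; pose N : R := (size F)%:R.
have N1 : 1 <= N by rewrite ler1n lt0n size_eq0.
have M0 : 0 <= M by rewrite ler0n.
(* With [t = K^-1] the expansion applies, and its total error [2 * N * M ^+ 2 * t ^+ 2] is at most
   half of the first-order gain [t] given by the drift. *)
pose K : R := 4 * N * M ^+ 2 + 2 * M + 1.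
have K1 : 1 <= K by rewrite /K; nra.
have K0 : 0 < K by lra.
pose t := K^-1.
have t0 : 0 < t by rewrite invr_gt0.
have tK : t * K = 1 by rewrite mulVf // gt_eqF.
have p1 : 0 <= t * (N * M ^+ 2).
  by rewrite mulr_ge0 ?(ltW t0) // mulr_ge0 ?exprn_ge0 //; lra.
have p2 : 0 <= t * M by rewrite mulr_ge0 // ltW.
have Mt : M * t <= 1 / 2 by rewrite /K in tK; lra.
have NMt : 2 * N * M ^+ 2 * t <= 1 / 2 by rewrite /K in tK; lra.
have q0 : 0 < (1 + t)^-1 by rewrite invr_gt0; lra.
exists ((1 + t)^-1), (1 - t / (2 * N)); split.
- by rewrite q0 invf_lt1; lra.
- have : 0 < t / (2 * N) by rewrite divr_gt0 //; lra.
  have : t / (2 * N) <= 1 by rewrite ler_pdivrMr; [have : t <= 1 by rewrite invf_le1|]; lra.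
  lra.
move=> g; have := dF g; set n := norm g.
have bnd f : f \in F -> ((1 + t)^-1) ^+ norm (g * f)%g <= ((1 + t)^-1) ^+ n *
    (1 - ((norm (g * f)%g)%:R - n%:R) * t + 2%:R * M ^+ 2 * t ^+ 2).
  move=> fF; have fM : ((norm f)%:R <= M :> R) by rewrite ler_nat leq_bigmax_seq.
  have h1 : ((norm (g * f)%g)%:R <= n%:R + (norm f)%:R :> R).
    by rewrite -natrD ler_nat word_normM.
  have h2 : (n%:R <= (norm (g * f)%g)%:R + (norm f)%:R :> R).
    rewrite -natrD ler_nat -(word_normV symS genS f) /n -{1}(mulgK f g).
    exact: (word_normM symS genS).
  apply: inv1D_expr_le => //; lra.
move=> drg; rewrite big_seq; apply: (le_trans (ler_sum _ bnd)); rewrite -big_seq.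
rewrite -mulr_sumr mulrC ler_wpM2r ?exprn_ge0 ?(ltW q0) // big_split /= big_split /=.
rewrite sumrN -!mulr_suml big_split /= sumrN !big_const_seq !count_predT !iter_addr !addr0 -natr_sum.
move: drg; rewrite -(ler_nat R) natrD natrM.
rewrite (_ : (1 - t / (2 * N)) * (size F)%:R = N - t / 2); last first.
  rewrite mulrBl mul1r -/N; congr (_ - _).
  by rewrite invfM mulrA mulfVK // gt_eqF //; lra.
rewrite -[n%:R *+ _]mulr_natr -[2 *+ _]mulr_natr -/N.
set s := (\sum_(f <- F) _)%N%:R => h.
have := NMt; move: (M ^+ 2) => M2 NMt'.
by rewrite expr2; nra.
Qed.

End Contraction.

(** * Exponential growth and a symmetric drift *)

Section Growth.
Variables (R : realType) (G : groupType) (S : set G) (D : nat).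
Hypotheses (symS : symmetric_set S) (genS : generates S) (finS : finite_set S).
Hypothesis hyp : hyp_const S D.
Hypothesis ne : nonelementary_group G.
Local Notation norm := (word_norm S).
Implicit Types (a c d g h : G).

(** A chosen decomposition determines [g], and [q ^+ norm g] is at most [q] raised to the sum of its
    exponents. So the series is bounded by the size of a ball times four geometric series. *)
Lemma double_coset_sum_finite (q : R) a n : 0 < q < 1 ->
  (forall g, (n <= norm g)%N -> [\/ (norm (a * g)%g < norm g)%N,
     (norm (a^-1 * g)%g < norm g)%N, (norm (g * a)%g < norm g)%N |
     (norm (g * a^-1)%g < norm g)%N]) ->
  (\esum_(g in [set: G]) (q ^+ norm g)%:E < +oo)%E.
Proof.
move=> q01 /(double_coset_reduce (a := a))red; have /andP[q0 q1] := q01.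
pose P g (t : G * ((nat * nat) * (nat * nat))) := [/\ (norm t.1 < n)%N,
  (t.2.1.1 + t.2.1.2 + (t.2.2.1 + t.2.2.2) <= norm g)%N &
  g = (a ^+ t.2.1.1 * a^-1 ^+ t.2.1.2 * t.1 * a ^+ t.2.2.1 * a^-1 ^+ t.2.2.2)%g].
have exP g : exists t, P g t.
  have [h [i [j [k [l [h1 h2 h3]]]]]] := red g.
  by exists (h, ((i, j), (k, l))); split=> //=; rewrite addnA.
have [tau Ptau] := choice exP.
pose B := [set h | (norm h < n)%N].
pose e (x : nat) := (q ^+ x)%:E : \bar R.
have e0 x : (0 <= e x)%E by rewrite lee_fin exprn_ge0 // ltW.
pose wt (p : (nat * nat) * (nat * nat)) := ((e p.1.1 * e p.1.2) * (e p.2.1 * e p.2.2))%E.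
have wt0 p : (0 <= wt p)%E by rewrite !mule_ge0.
have inj_tau : set_inj [set: G] tau.
  move=> g1 g2 _ _ E; have [_ _ ->] := Ptau g1; have [_ _ ->] := Ptau g2.
  by rewrite E.
apply: (@le_lt_trans _ _ (\esum_(g in [set: G]) (1 * wt (tau g).2))%E).
  apply: le_esum => g _; rewrite mul1e /wt /e -!EFinM -!exprD lee_fin.
  by have [_ le _] := Ptau g; rewrite ler_wiXn2l // ltW.
rewrite -(esum_image _ tau (fun t => 1 * wt t.2)%E) //.
have sub : tau @` [set: G] `<=` B `*` [set: (nat * nat) * (nat * nat)].
  by move=> _ [g _ <-]; have [h1 _ _] := Ptau g; split.
apply: (@le_lt_trans _ _ (\esum_(t in B `*` [set: (nat * nat) * (nat * nat)]) (1 * wt t.2))%E).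
  rewrite [leRHS](esumID (tau @` [set: G])); last by move=> t _; rewrite mul1e.
  by rewrite (setIidr sub) leeDl // esum_ge0 // => t _; rewrite mul1e.
apply: le_lt_trans (@esum_setX_le R _ _ B setT (fun=> 1%E) wt _ _) _ => //.
have lt_prod (x y : \bar R) : (0 <= x)%E -> (0 <= y)%E -> (x < +oo -> y < +oo -> x * y < +oo)%E.
  by move=> x0 y0 x1 y1; rewrite -ge0_fin_numE ?mule_ge0 // fin_numM // ge0_fin_numE.
have esum0 (T : choiceType) (A : set T) (f : T -> \bar R) : (forall x, 0 <= f x)%E -> (0 <= \esum_(x in A) f x)%E.
  by move=> f0; apply: esum_ge0.
have geo : (\esum_(x in [set: nat]) e x < +oo)%E.
  exact: le_lt_trans (esum_geometric_le q01) (ltry _).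
have geo2 : (\esum_(p in [set: nat * nat]) (e p.1 * e p.2) < +oo)%E.
  rewrite -setXTT; apply: le_lt_trans (@esum_setX_le R _ _ setT setT e e _ _) _ => //.
  by apply: lt_prod => //; exact: esum0.
apply: (lt_prod _ _); rewrite ?esum0 //.
- have [s Bs] : exists s : seq G, B `<=` [set` s].
    have /finite_seqP[s Es] := finite_norm_ball symS genS n finS.
    by exists s => h; rewrite -Es /B /=; exact: ltnW.
  have -> : \esum_(x in B) (1 : \bar R)%E = \esum_(x in B) (1%R : R)%:E by [].
  apply: le_lt_trans (@esum_ub R _ B (fun=> 1) (size s)%:R _) (ltry _) => s' us' s'B.
  rewrite big_const_seq count_predT iter_addr addr0 ler_nat.
  by apply: uniq_leq_size => // x /s'B/Bs.
- rewrite -setXTT; apply: le_lt_trans (@esum_setX_le R _ _ setT setT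
    (fun p : nat * nat => e p.1 * e p.2)%E (fun p : nat * nat => e p.1 * e p.2)%E _ _) _.
  + by move=> p; exact: mule_ge0.
  + by move=> p; exact: mule_ge0.
  + by apply: lt_prod => //; apply: esum0 => p; exact: mule_ge0.
Qed.

(* Otherwise, summing the contraction inequality over G gives the same finite
   positive sum on both sides, up to a factor rho < 1 (translations preserve it). *)
Lemma drift_growth : exists q : R, 0 < q < 1 /\
  ~ (\esum_(g in [set: G]) (q ^+ norm g)%:E < +oo)%E.
Proof.
have [F [dF F0]] := nonelementary_drift symS genS finS hyp ne.
have [q [rho [q01 /andP[rho0 rho1] con]]] := drift_contract R symS genS dF F0.
exists q; split=> // fin; have /andP[q0 q1] := q01.
set Z := (\esum_(g in [set: G]) (q ^+ norm g)%:E)%E in fin.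
have qe0 g : (0 <= (q ^+ norm g)%:E)%E by rewrite lee_fin exprn_ge0 // ltW.
have Z1 : (1 <= Z)%E.
  have <- : (\esum_(g in [set 1%g : G]) (q ^+ norm g)%:E = 1)%E.
    by rewrite esum_set1 // word_norm1 // expr0.
  rewrite /Z [leRHS](esumID [set 1%g : G]) // setTI leeDl // esum_ge0 // => g _.
have shift f : (\esum_(g in [set: G]) (q ^+ norm (g * f)%g)%:E = Z)%E.
  rewrite /Z [RHS](reindex_esum [set: G] [set: G] (fun g => g * f)%g) //.
  split=> //; first by move=> g1 g2 _ _; exact: mulIg.
  by move=> g _; exists (g * f^-1)%g; rewrite ?mulgVK.
have NZ (s : seq G) : (\sum_(f <- s) Z = (size s)%:R%:E * Z)%E.
  elim: s => [|f s IH]; first by rewrite big_nil mul0e.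
  by rewrite big_cons IH /= -natr1 EFinD ge0_muleDl ?lee_fin // mul1e addeC.
have : ((size F)%:R%:E * Z <= Z * (rho * (size F)%:R)%:E)%E.
  rewrite -NZ -(eq_bigr _ (fun f _ => shift f)) -esum_sum; last by move=> *; exact: qe0.
  apply: le_trans (esum_mulr_le _ _); last 2 first.
  - by rewrite lee_fin mulr_ge0.
  - by move=> g _; exact: qe0.
  by apply: le_esum => g _; rewrite sumEFin -EFinM lee_fin mulrC; exact: con.
have Zfin : Z \is a fin_num by rewrite ge0_fin_numE // (le_trans _ Z1).
rewrite -(fineK Zfin) -!EFinM lee_fin.
have : 1 <= fine Z by rewrite -lee_fin fineK.
have : 0 < (size F)%:R :> R by rewrite ltr0n lt0n size_eq0.
move: (fine Z) ((size F)%:R) => z N N0 z1.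
have : 0 < N * z * (1 - rho) by rewrite !mulr_gt0 // ?subr_gt0 // (lt_le_trans _ z1).
lra.
Qed.

(** By growth, some long [d] is shortened by [a] and [a^-1] on neither side. The right side concerns
    [d^-1] after inversion, so both [d] and [d^-1] diverge from [c] and [c^-1], as a family closed
    under inversion requires. *)
Lemma symmetric_drift : exists F, [/\ drift S F, F != [::] &
  perm_eq [seq (f^-1)%g | f <- F] F].
Proof.
have [a la] := exists_lox symS genS finS hyp (nonelementary_infinite ne).
set K := (norm a + 2 * D)%N; pose n := (2 * K + 2 * D).+1.
have [d [dn d1 d2 d3 d4]] : exists d, [/\ (n <= norm d)%N,
    (norm d <= norm (a * d)%g)%N, (norm d <= norm (a^-1 * d)%g)%N,
    (norm d <= norm (d * a)%g)%N & (norm d <= norm (d * a^-1)%g)%N].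
  apply: contrapT => no; have [q [q01]] := drift_growth; apply.
  apply: (double_coset_sum_finite (a := a) (n := n) q01) => g gn.
  apply: contrapT => h; apply: no; exists g; split=> //;
    rewrite leqNgt; apply/negP => lt; apply: h.
  - by constructor 1.
  - by constructor 2.
  - by constructor 3.
  - by constructor 4.
have nV := word_normV symS genS.
have [k powk] := lox_pow symS genS hyp (norm d).
have [n1 ca] := powk a la; have [_ ca'] := powk _ (loxV symS genS la).
set c := (a ^+ k)%g in n1 ca; rewrite expVgn -/c nV in ca'.
have lc g : (norm g <= norm (a * g)%g)%N -> (norm g <= norm (a^-1 * g)%g)%N ->
    (ip S c g <= K)%N /\ (ip S c^-1%g g <= K)%N.
  move=> g1 g2; split; first exact: (lox_pow_ip symS genS hyp la ca g2).
  have := @lox_pow_ip _ _ _ symS genS hyp (a^-1)%g (c^-1)%g g (loxV symS genS la).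
  by rewrite nV invgK; apply.
exists [:: c; c; c^-1; c^-1; d; d^-1]%g; split=> //; last first.
  by rewrite /= !invgK; apply/permP => x /=; lia.
have [h1 h2] := lc d d1 d2.
have e1 : (norm (d^-1)%g <= norm (a * d^-1)%g)%N.
  by rewrite nV -[norm (a * _)%g]nV invgM invgK.
have e2 : (norm (d^-1)%g <= norm (a^-1 * d^-1)%g)%N.
  by rewrite nV -[norm (_^-1 * _)%g]nV invgM !invgK.
have [h3 h4] := lc _ e1 e2.
apply: (@drift6 _ _ _ symS genS hyp K) => //.
  by rewrite dn /=; lia.
exact: (lox_pow_ipV symS genS hyp la ca ca').
Qed.

End Growth.

(** * Finitely supported functions *)

Section FiniteSum.
Variables (R : realType) (G : groupType).
Implicit Types (phi psi : G -> R) (f g : G).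

Definition fin_supp phi := finite_set [set g | phi g != 0].
(** The value is 0 by default when the support is infinite; hence the support hypotheses in the
    linearity lemmas. *)
Definition fsum phi : R := \sum_(g \in [set: G]) phi g.

Lemma fin_supp_seq phi : fin_supp phi ->
  exists s : seq G, uniq s /\ (forall g, phi g != 0 -> g \in s).
Proof.
move=> /finite_seqP[s Es]; exists (undup s); rewrite undup_uniq; split=> // g.
by rewrite mem_undup; have := Es; rewrite predeqE => /(_ g)[+ _] => /[apply].
Qed.

Lemma fin_supp0 phi psi : fin_supp phi -> (forall g, phi g = 0 -> psi g = 0) ->
  fin_supp psi.
Proof.
move=> fphi h; apply: sub_finite_set fphi => g /=.
by apply: contra_neq; exact: h.
Qed.

Lemma fin_supp_add phi psi : fin_supp phi -> fin_supp psi ->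
  fin_supp (fun g => phi g + psi g).
Proof.
move=> fphi fpsi; have : finite_set ([set g | phi g != 0] `|` [set g | psi g != 0]).
  by rewrite finite_setU.
apply: sub_finite_set => g /=.
by have [->|] := eqVneq (phi g) 0; [rewrite add0r; right|left].
Qed.

Lemma fin_supp_sum (I : Type) (r : seq I) (phi : I -> G -> R) :
  (forall i, fin_supp (phi i)) -> fin_supp (fun g => \sum_(i <- r) phi i g).
Proof.
move=> fphi; elim: r => [|i r IH].
  apply: (sub_finite_set _ (finite_set0 G)) => g /=.
  by rewrite big_nil eqxx.
apply: (fin_supp0 (fin_supp_add (fphi i) IH)) => g; by rewrite big_cons.
Qed.

Lemma fin_supp_shift phi f : fin_supp phi -> fin_supp (fun g => phi (g * f)%g).
Proof.
move=> fphi; apply: sub_finite_set (finite_image (fun g => g * f^-1)%g fphi).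
by move=> g /= h; exists (g * f)%g; rewrite ?mulgK.
Qed.

Lemma fsumE phi s : uniq s -> (forall g, phi g != 0 -> g \in s) ->
  fsum phi = \sum_(g <- s) phi g.
Proof.
move=> us hs; rewrite fsbig_seq // /fsum; apply: esym; apply: fsbig_widen => //.
by move=> g [_ /= gs]; apply/eqP; apply: contrapT => /negP/hs.
Qed.

Lemma fsum_shift phi f : fsum (fun g => phi (g * f)%g) = fsum phi.
Proof.
rewrite /fsum [RHS](reindex_fsbigT (fun g => g * f)%g) //.
by exists (fun g => g * f^-1)%g => g; rewrite ?mulgK ?mulgVK.
Qed.

Lemma fsum_ge0 phi : (forall g, 0 <= phi g) -> 0 <= fsum phi.
Proof. by move=> h; apply: fsumr_ge0. Qed.

Lemma fsumD phi psi : fin_supp phi -> fin_supp psi ->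
  fsum (fun g => phi g + psi g) = fsum phi + fsum psi.
Proof.
move=> /fin_supp_seq[s [us hs]] /fin_supp_seq[t [ut ht]].
have cov g : g \in s \/ g \in t -> g \in undup (s ++ t).
  by rewrite mem_undup mem_cat => -[] ->; rewrite ?orbT.
rewrite !(@fsumE _ (undup (s ++ t))) ?undup_uniq ?big_split // => g.
- by move/ht => gt; apply: cov; right.
- by move/hs => gt; apply: cov; left.
- have [->|] := eqVneq (phi g) 0; first by rewrite add0r => /ht gt; apply: cov; right.
  by move=> /hs gs _; apply: cov; left.
Qed.

Lemma fsumZ c phi : fin_supp phi -> fsum (fun g => c * phi g) = c * fsum phi.
Proof.
move=> /fin_supp_seq[s [us hs]]; rewrite !(@fsumE _ s) ?mulr_sumr // => g h.
by apply: hs; apply: contra_neq h => ->; rewrite mulr0.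
Qed.

Lemma fsum_sum (I : Type) (r : seq I) (phi : I -> G -> R) :
  (forall i, fin_supp (phi i)) ->
  fsum (fun g => \sum_(i <- r) phi i g) = \sum_(i <- r) fsum (phi i).
Proof.
move=> fphi; elim: r => [|i r IH].
  rewrite big_nil (@fsumE _ [::]) ?big_nil // => g.
  by rewrite big_nil eqxx.
rewrite big_cons -IH -fsumD //; last exact: fin_supp_sum.
by congr fsum; apply/funext => g; rewrite big_cons.
Qed.

Lemma fsum_le phi psi : fin_supp phi -> fin_supp psi ->
  (forall g, phi g <= psi g) -> fsum phi <= fsum psi.
Proof.
move=> fphi fpsi h; rewrite -subr_ge0 -mulN1r -fsumZ // -fsumD //; last first.
  by apply: (fin_supp0 fphi) => g ->; rewrite mulr0.
by apply: fsum_ge0 => g; rewrite mulN1r subr_ge0.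
Qed.

End FiniteSum.

(** * Correlations, displacements and Schur's test *)

Section SpectralGap.
Variables (R : realType) (G : groupType).
Implicit Types (phi psi : G -> R) (f g : G).

Definition sqn phi : R := fsum (fun g => phi g ^+ 2).
Definition corr f phi psi : R := fsum (fun g => phi (g * f)%g * psi g).
Definition disp f phi : R := fsum (fun g => (phi g - phi (g * f)%g) ^+ 2).

Lemma fin_supp_sqr phi : fin_supp phi -> fin_supp (fun g => phi g ^+ 2).
Proof. by move=> h; apply: (fin_supp0 h) => g ->; rewrite expr0n. Qed.

Lemma fin_supp_corr f phi psi : fin_supp phi -> fin_supp (fun g => phi (g * f)%g * psi g).
Proof. by move=> h; apply: (fin_supp0 (fin_supp_shift f h)) => g ->; rewrite mul0r. Qed.

Lemma fin_suppZ c phi : fin_supp phi -> fin_supp (fun g => c * phi g).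
Proof. by move=> h; apply: (fin_supp0 h) => g ->; rewrite mulr0. Qed.

Lemma sqn_ge0 phi : 0 <= sqn phi.
Proof. by apply: fsum_ge0 => g; rewrite sqr_ge0. Qed.

Lemma sqn_shift f phi : sqn (fun g => phi (g * f)%g) = sqn phi.
Proof. exact: (fsum_shift (fun g => phi g ^+ 2)). Qed.

Lemma disp_ge0 f phi : 0 <= disp f phi.
Proof. by apply: fsum_ge0 => g; rewrite sqr_ge0. Qed.

Lemma fin_supp_disp f phi : fin_supp phi -> fin_supp (fun g => (phi g - phi (g * f)%g) ^+ 2).
Proof.
move=> h; apply: (@fin_supp_sqr (fun g => phi g - phi (g * f)%g)).
apply: (@fin_supp_add _ _ phi (fun g => - phi (g * f)%g)) => //.
by apply: (fin_supp0 (fin_supp_shift f h)) => g ->; rewrite oppr0.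
Qed.

Lemma dispE f phi : fin_supp phi -> disp f phi = 2 * sqn phi - 2 * corr f phi phi.
Proof.
move=> h; have h1 := fin_supp_sqr h.
have h2 : fin_supp (fun g => phi (g * f)%g ^+ 2) by exact: (fin_supp_shift f h1).
have h3 : fin_supp (fun g => - 2 * (phi (g * f)%g * phi g)).
  by apply: (@fin_suppZ (- 2) (fun g => phi (g * f)%g * phi g)); exact: fin_supp_corr.
transitivity (fsum (fun g => phi g ^+ 2 + phi (g * f)%g ^+ 2 + - 2 * (phi (g * f)%g * phi g))).
  by congr fsum; apply/funext => g; lra.
rewrite (fsumD (fin_supp_add h1 h2) h3) (fsumD h1 h2) fsumZ; last exact: fin_supp_corr.
have := sqn_shift f phi; rewrite /sqn /corr => ->; lra.
Qed.

Lemma disp1 phi : disp 1%g phi = 0.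
Proof.
rewrite /disp (@fsumE _ _ _ [::]) ?big_nil // => g.
by rewrite mulg1 subrr expr0n eqxx.
Qed.

Lemma dispM f f' phi : fin_supp phi ->
  disp (f * f')%g phi <= 2 * disp f phi + 2 * disp f' phi.
Proof.
move=> h; rewrite -[disp f' phi](fsum_shift (fun g => (phi g - phi (g * f')%g) ^+ 2) f).
have d1 := fin_supp_disp f h; have d2 := fin_supp_shift f (fin_supp_disp f' h).
rewrite -!fsumZ // -fsumD; [|exact: (fin_suppZ _ d1)|exact: (fin_suppZ _ d2)].
apply: fsum_le; [exact: fin_supp_disp|exact: (fin_supp_add (fin_suppZ 2 d1) (fin_suppZ 2 d2))|].
move=> g; rewrite mulgA.
move: (phi g) (phi (g * f)%g) (phi (g * f * f')%g) => x y z.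
have := sqr_ge0 (x - 2 * y + z); nra.
Qed.

(** Weighted arithmetic-geometric inequality: twice [phi (g * f) * phi g] is at most
    [a f g + a f^-1 (g * f)]. Translation invariance and the symmetry of [F] make the two sums
    equal, and the hypothesis on [v] bounds each. *)
Lemma schur_test (F : seq G) (v : G -> R) (c : R) phi :
  perm_eq [seq (f^-1)%g | f <- F] F -> (forall g, 0 < v g) ->
  (forall g, \sum_(f <- F) v (g * f)%g <= c * v g) -> fin_supp phi ->
  \sum_(f <- F) corr f phi phi <= c * sqn phi.
Proof.
move=> symF v0 hv h.
pose a f g := phi g ^+ 2 * v (g * f)%g / v g.
have fa f : fin_supp (a f).
  by apply: (fin_supp0 h) => g g0; rewrite /a g0 expr0n !mul0r.
have sa : \sum_(f <- F) fsum (a f) <= c * sqn phi.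
  rewrite -fsum_sum // -fsumZ; last exact: fin_supp_sqr.
  apply: fsum_le => [||g]; [exact: fin_supp_sum|exact/fin_suppZ/fin_supp_sqr|].
  rewrite /a -mulr_suml -mulr_sumr ler_pdivrMr // (mulrC c) -[X in _ <= X]mulrA.
  by rewrite ler_wpM2l ?sqr_ge0.
have two f : 2 * corr f phi phi <= fsum (a f) + fsum (a (f^-1)%g).
  rewrite -(fsum_shift (a (f^-1)%g) f) -fsumZ; last exact: fin_supp_corr.
  rewrite -fsumD //; last exact: fin_supp_shift.
  apply: fsum_le; [exact/fin_suppZ/fin_supp_corr|by apply: fin_supp_add => //; exact: fin_supp_shift|].
  move=> g; rewrite /a mulgK.
  have := v0 g; have := v0 (g * f)%g.
  move: (v g) (v (g * f)%g) (phi g) (phi (g * f)%g) => p q x y q0 p0.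
  rewrite -subr_ge0 (_ : _ - _ = (x * q - y * p) ^+ 2 / (p * q)).
    by rewrite divr_ge0 ?sqr_ge0 // mulr_ge0 // ltW.
  have p0' : p != 0 by rewrite gt_eqF.
  have q0' : q != 0 by rewrite gt_eqF.
  apply: (mulIf (mulf_neq0 p0' q0')); rewrite mulfVK ?mulf_neq0 //.
  rewrite mulrBl mulrDl (_ : x ^+ 2 * q / p * (p * q) = x ^+ 2 * q * q); last first.
    by rewrite mulrA mulfVK.
  rewrite (_ : y ^+ 2 * p / q * (p * q) = y ^+ 2 * p * p); last first.
    by rewrite (mulrC p q) mulrA mulfVK.
  lra.
have : \sum_(f <- F) 2 * corr f phi phi <= \sum_(f <- F) (fsum (a f) + fsum (a (f^-1)%g)).
  by apply: ler_sum => f _; exact: two.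
rewrite big_split /= -mulr_sumr.
have -> : \sum_(f <- F) fsum (a (f^-1)%g) = \sum_(f <- F) fsum (a f).
  by rewrite -[RHS](perm_big _ symF) big_map.
lra.
Qed.

End SpectralGap.

(** * The spectral gap *)

Lemma admissible_enum (R : realType) (G : groupType) (mu : G -> R) :
  admissible mu -> exists ts : seq G, [/\ uniq ts, supp mu = [set` ts],
    \sum_(s <- ts) mu s = 1 & perm_eq [seq (s^-1)%g | s <- ts] ts].
Proof.
move=> [[mu0 mu1] muV finT _].
have /finite_seqP[ts0 E] := finT; pose ts := undup ts0.
have Ets : supp mu = [set` ts].
  by rewrite E; apply/seteqP; split=> g; rewrite /= mem_undup.
have uts : uniq ts by rewrite undup_uniq.
exists ts; split=> //.
  have := mu1; rewrite (esumID (supp mu)) => [|g _]; last by rewrite lee_fin.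
  rewrite !setTI [X in (_ + X)%E]esum1 ?adde0 => [|g]; last first.
    by move=> /negP; rewrite /supp /= -leNgt => h; apply/eqP; rewrite eqe eq_le h mu0.
  rewrite esum_fset //; last by move=> g _; rewrite lee_fin.
  by rewrite Ets -fsbig_seq // sumEFin => -[].
apply: uniq_perm => //; first by rewrite map_inj_uniq //; exact: invg_inj.
have memV g : g \in ts -> (g^-1)%g \in ts.
  by have := Ets; rewrite predeqE => h; move=> /h gT; apply/h; rewrite /supp /= -muV.
move=> g; apply/mapP/idP => [[s /memV + ->//]|/memV h].
by exists (g^-1)%g; rewrite ?invgK.
Qed.

Section Walk.
Variables (R : realType) (G : groupType) (mu : G -> R) (ts : seq G).
Hypotheses (uts : uniq ts) (Ets : supp mu = [set` ts]) (sum_mu : \sum_(s <- ts) mu s = 1).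
Hypothesis tsV : perm_eq [seq (s^-1)%g | s <- ts] ts.
Hypotheses (muV : forall g, mu g = mu (g^-1)%g) (gen : generates (supp mu)).
Implicit Types (phi psi : G -> R) (f g : G).

Lemma supp_gt0 s : s \in ts -> 0 < mu s.
Proof. by move=> h; have : supp mu s by rewrite Ets. Qed.

Lemma supp_symmetric : symmetric_set (supp mu).
Proof. by move=> s; rewrite /supp /= muV. Qed.

(** Twice the Dirichlet form of the random walk; [qform] is the bilinear form of its Markov
    operator. *)
Definition energy phi : R := \sum_(s <- ts) mu s * disp s phi.
Definition qform phi psi : R := \sum_(s <- ts) mu s * corr s phi psi.

Lemma energy_ge0 phi : 0 <= energy phi.
Proof.
rewrite /energy big_seq; apply: sumr_ge0 => s /supp_gt0 h.
by rewrite mulr_ge0 ?disp_ge0 // ltW.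
Qed.

Lemma energyE phi : fin_supp phi -> energy phi = 2 * sqn phi - 2 * qform phi phi.
Proof.
move=> h; have -> : 2 * sqn phi = \sum_(s <- ts) mu s * (2 * sqn phi).
  by rewrite -mulr_suml sum_mu mul1r.
rewrite /energy /qform mulr_sumr -sumrB.
by apply: eq_bigr => s _; rewrite dispE //; lra.
Qed.

(** Comparison of Dirichlet forms by induction on a word for [f]: prepending [s] doubles the
    constant by [dispM] and adds [2 / mu s], as the energy dominates [mu s * disp s phi]. *)
Lemma disp_le_energy f : exists2 C, 0 <= C &
  forall phi, fin_supp phi -> disp f phi <= C * energy phi.
Proof.
have [w Ww <-] := word_exists supp_symmetric gen f.
elim: w Ww => [_|s w IH /words_cons[Ts /IH[C C0 hC]]].
  by exists 0 => // phi _; rewrite word_eval_nil disp1 mul0r.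
have sts : s \in ts by move: Ts; rewrite Ets.
have s0 := supp_gt0 sts.
exists (2 * (mu s)^-1 + 2 * C).
  by rewrite addr_ge0 ?mulr_ge0 ?invr_ge0 // ltW.
move=> phi h; rewrite word_eval_cons; apply: le_trans (dispM s (word_eval w) h) _.
have := hC phi h.
have : disp s phi <= (mu s)^-1 * energy phi.
  rewrite mulrC ler_pdivlMr // mulrC /energy (big_rem s) //= lerDl.
  rewrite big_seq; apply: sumr_ge0 => t /mem_rem/supp_gt0 t0.
  by rewrite mulr_ge0 ?disp_ge0 // ltW.
by lra.
Qed.

Lemma sum_disp_le_energy (F : seq G) : exists2 C, 0 <= C &
  forall phi, fin_supp phi -> \sum_(f <- F) disp f phi <= C * energy phi.
Proof.
elim: F => [|f F [C C0 hC]]; first by exists 0 => // phi _; rewrite big_nil mul0r.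
have [C' C'0 hC'] := disp_le_energy f.
exists (C' + C); first exact: addr_ge0.
by move=> phi h; rewrite big_cons mulrDl lerD ?hC ?hC'.
Qed.

Lemma spectral_gap (F : seq G) (v : G -> R) (rho : R) :
  F != [::] -> perm_eq [seq (f^-1)%g | f <- F] F -> (forall g, 0 < v g) -> rho < 1 -> 0 <= rho ->
  (forall g, \sum_(f <- F) v (g * f)%g <= rho * (size F)%:R * v g) ->
  exists2 theta, 0 < theta < 1 &
    forall phi, fin_supp phi -> qform phi phi <= theta * sqn phi.
Proof.
move=> F0 symF v0 rho1 rho0 hv; pose N : R := (size F)%:R.
have N0 : 0 < N by rewrite ltr0n lt0n size_eq0.
have [C C0 hC] := sum_disp_le_energy F.
(* The extra [2 * N] makes [C1] positive and [k] at most 1/2, so that [1 - k] lies in (0,1). *)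
pose C1 := C + 2 * N; have C10 : 0 < C1 by rewrite ltr_wpDl // mulr_gt0.
pose k := N * (1 - rho) / C1.
have k0 : 0 < k by rewrite divr_gt0 // mulr_gt0 // subr_gt0.
have kC : k * C1 = N * (1 - rho) by rewrite mulfVK // gt_eqF.
have k1 : k <= 1 / 2.
  have : 0 <= N * rho by rewrite mulr_ge0 // ltW.
  by rewrite ler_pdivrMr // /C1; lra.
exists (1 - k); first by lra.
move=> phi h; have := schur_test symF v0 hv h.
have := hC phi h.
have -> : \sum_(f <- F) disp f phi = 2 * N * sqn phi - 2 * \sum_(f <- F) corr f phi phi.
  under eq_bigr do rewrite dispE //.
  rewrite sumrB [X in _ = _ - X]mulr_sumr; congr (_ - _); rewrite big_const_seq count_predT iter_addr addr0.
  by rewrite -mulr_natr -/N; lra.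
rewrite -/N => h1 h2.
have E0 := energy_ge0 phi; have EE := energyE h.
have h3 : 2 * N * (1 - rho) * sqn phi <= C1 * energy phi.
  have : 0 <= N * energy phi by rewrite mulr_ge0 // ltW.
  rewrite /C1; lra.
have h4 : C1 * (2 * k * sqn phi) <= C1 * energy phi.
  by apply: le_trans h3; rewrite -[X in _ <= X * _]mulrA -kC; lra.
by move: h4; rewrite ler_pM2l // EE; lra.
Qed.

(** The probability that [n] steps of the random walk started at [g] end at the identity. *)
Fixpoint walk n : G -> R :=
  if n is m.+1 then fun g => \sum_(s <- ts) mu s * walk m (g * s)%g
  else fun g => (g == 1%g)%:R.

Lemma walk_ge0 n g : 0 <= walk n g.
Proof.
elim: n g => [|n IH] g /=; first by rewrite ler0n.
rewrite big_seq; apply: sumr_ge0 => s /supp_gt0 h.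
by rewrite mulr_ge0 // ltW.
Qed.

Lemma walk_fin_supp n : fin_supp (walk n).
Proof.
elim: n => [|n IH] /=.
  apply: sub_finite_set (finite_set1 (1%g : G)) => g /=.
  by have [->//|_] := eqVneq g 1%g; rewrite eqxx.
apply: fin_supp_sum => s; apply: (@fin_suppZ _ _ (mu s) (fun g => walk n (g * s)%g)).
exact: fin_supp_shift.
Qed.

Lemma qform_walkl n psi : qform (walk n) psi = fsum (fun g => walk n.+1 g * psi g).
Proof.
have h s : fin_supp (fun g => walk n (g * s)%g * psi g).
  exact/fin_supp_corr/walk_fin_supp.
transitivity (fsum (fun g => \sum_(s <- ts) mu s * (walk n (g * s)%g * psi g))).
  rewrite fsum_sum; last by move=> s; apply: fin_suppZ (h s).
  by apply: eq_bigr => s _; rewrite fsumZ.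
congr fsum; apply/funext => g /=; rewrite mulr_suml.
by apply: eq_bigr => s _; rewrite mulrA.
Qed.

Lemma corrV s phi psi : corr (s^-1)%g phi psi = corr s psi phi.
Proof.
rewrite /corr -(fsum_shift _ s); congr fsum; apply/funext => g.
by rewrite mulgK mulrC.
Qed.

Lemma qformC phi psi : qform phi psi = qform psi phi.
Proof.
rewrite /qform -[LHS](perm_big _ tsV) big_map; apply: eq_bigr => s _.
by rewrite -muV corrV.
Qed.

(* By Cauchy-Schwarz in the plane, the bilinear form at (phi, psi) is dominated by
   the quadratic form at the modulus of (phi, psi); hence a bipartite walk is no obstacle. *)
Lemma qform_polar theta phi psi :
  (forall chi, fin_supp chi -> qform chi chi <= theta * sqn chi) ->
  fin_supp phi -> fin_supp psi ->
  2 * qform phi psi <= theta * (sqn phi + sqn psi).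
Proof.
move=> gap hphi hpsi; pose chi g := Num.sqrt (phi g ^+ 2 + psi g ^+ 2).
have chi0 g : 0 <= phi g ^+ 2 + psi g ^+ 2 by rewrite addr_ge0 ?sqr_ge0.
have hchi : fin_supp chi.
  apply: (fin_supp0 (fin_supp_add (fin_supp_sqr hphi) (fin_supp_sqr hpsi))) => g.
  by rewrite /chi => ->; rewrite sqrtr0.
have -> : sqn phi + sqn psi = sqn chi.
  rewrite /sqn -fsumD; try exact: fin_supp_sqr.
  by congr fsum; apply/funext => g; rewrite /chi sqr_sqrtr.
apply: le_trans (gap _ hchi).
rewrite mulrDl mul1r {2}qformC /qform -big_split /= !big_seq; apply: ler_sum => s /supp_gt0 s0.
rewrite -mulrDr ler_pM2l // /corr -fsumD; try exact: fin_supp_corr.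
apply: fsum_le; [|exact: fin_supp_corr|].
  by apply: fin_supp_add; exact: fin_supp_corr.
move=> g; rewrite /chi -sqrtrM //.
apply: le_trans (ler_norm _) _; rewrite -sqrtr_sqr ler_wsqrtr //.
move: (phi _) (phi g) (psi _) (psi g) => a a' b b'.
have := sqr_ge0 (a * a' - b * b'); nra.
Qed.

Lemma walk_sqn_decay theta : 0 < theta ->
  (forall chi, fin_supp chi -> qform chi chi <= theta * sqn chi) ->
  forall n, sqn (walk n) <= theta ^+ (2 * n).
Proof.
move=> th0 gap; elim=> [|n IH].
  rewrite muln0 expr0 /sqn (@fsumE _ _ _ [:: 1%g]) // ?big_seq1 /= ?eqxx ?expr1n // => g /=.
  by rewrite inE; apply: contra_neqT => /negPf ->; rewrite expr0n.
have hn := walk_fin_supp n; have hn1 := walk_fin_supp n.+1.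
(* This scaling balances the polarised inequality, which then says that [sqn] decreases by the
   factor [theta ^+ 2] at each step. *)
pose psi g := theta^-1 * walk n.+1 g.
have hpsi : fin_supp psi by apply: fin_suppZ.
have := qform_polar gap hn hpsi.
rewrite qform_walkl.
have -> : fsum (fun g => walk n.+1 g * psi g) = theta^-1 * sqn (walk n.+1).
  rewrite /sqn -fsumZ; last exact: fin_supp_sqr.
  by congr fsum; apply/funext => g; rewrite /psi expr2 mulrCA.
have -> : sqn psi = theta^-1 ^+ 2 * sqn (walk n.+1).
  rewrite /sqn -fsumZ; last exact: fin_supp_sqr.
  by congr fsum; apply/funext => g; rewrite /psi exprMn.
rewrite mulnS exprD; move: (sqn (walk n)) (sqn (walk n.+1)) (theta ^+ (2 * n)) IH => x y z xz.
have tt : theta * theta^-1 = 1 by rewrite divff // gt_eqF.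
have -> : theta * (x + theta^-1 ^+ 2 * y) = theta * x + theta^-1 * y.
  by rewrite mulrDr expr2 !mulrA tt mul1r.
move=> le.
have le1 : theta^-1 * y <= theta * x by lra.
have : theta * (theta^-1 * y) <= theta * (theta * x) by rewrite ler_pM2l.
rewrite !mulrA tt mul1r -expr2 => le2; apply: le_trans le2 _.
by rewrite ler_pM2l // exprn_gt0.
Qed.

Lemma walk_decay theta : 0 < theta ->
  (forall chi, fin_supp chi -> qform chi chi <= theta * sqn chi) ->
  forall n g, walk n g <= theta ^+ n.
Proof.
move=> th0 gap n g; have := walk_sqn_decay th0 gap n.
have [s [us hs]] := fin_supp_seq (fin_supp_sqr (walk_fin_supp n)).
have : walk n g ^+ 2 <= sqn (walk n).
  have [->|nz] := eqVneq (walk n g) 0; first by rewrite expr0n sqn_ge0.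
  rewrite /sqn (fsumE us hs) (big_rem g) /=; last by apply: hs; rewrite expf_neq0.
  by rewrite lerDl; apply: sumr_ge0 => h _; rewrite sqr_ge0.
move=> /le_trans h /h; rewrite mulnC exprM ler_sqr // nnegrE ?walk_ge0 //.
by rewrite exprn_ge0 // ltW.
Qed.

Lemma sum_weight_le_walk n g (l : seq (seq G)) : uniq l ->
  (forall w, w \in l -> [/\ words (supp mu) w, size w = n & (g * word_eval w)%g = 1%g]) ->
  \sum_(w <- l) weight mu w <= walk n g.
Proof.
elim: n g l => [|n IH] g l ul hl.
  have : {subset l <= [:: [::]]}.
    by move=> w /hl[_ /size0nil -> _]; rewrite inE.
  case: l ul hl => [_ _ _|w l ul hl sub]; first by rewrite big_nil /= ler0n.
  have wnil : w = [::] by apply/eqP; rewrite -mem_seq1 sub // mem_head.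
  have -> : l = [::].
    case: l ul hl sub => // w' l ul hl sub.
    have w'nil : w' = [::] by apply/eqP; rewrite -mem_seq1 sub // !inE eqxx orbT.
    by move: ul; rewrite wnil w'nil.
  have [_ _] := hl w (mem_head _ _); rewrite wnil word_eval_nil mulg1 => ->.
  by rewrite big_seq1 /weight big_nil /= eqxx.
have splitE : \sum_(w <- l) weight mu w =
    \sum_(s <- ts) \sum_(w <- l | head 1%g w == s) weight mu w.
  rewrite (exchange_big_dep xpredT) //= big_seq [RHS]big_seq; apply: eq_bigr => w wl.
  have [Ww sw _] := hl w wl.
  rewrite -big_filter (_ : [seq s <- ts | _] = [:: head 1%g w]) ?big_seq1 //.
  case: w Ww sw {wl} => // s w /words_cons[Ts _] _ /=.
  have sts : s \in ts by move: Ts; rewrite Ets.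
  transitivity [seq x <- ts | x == s]; first by apply: eq_filter => x; rewrite eq_sym.
  exact: filter_pred1_uniq.
rewrite splitE /= !big_seq; apply: ler_sum => s sts.
have -> : \sum_(w <- l | head 1%g w == s) weight mu w =
    mu s * \sum_(w <- [seq behead w | w <- l & head 1%g w == s]) weight mu w.
  rewrite mulr_sumr big_map big_filter big_seq_cond [RHS]big_seq_cond.
  apply: eq_bigr => w /andP[/hl[_ sw _]].
  by case: w sw => // x w _ /= /eqP ->; rewrite /weight big_cons.
rewrite ler_pM2l ?supp_gt0 //; apply: IH.
  rewrite map_inj_in_uniq ?filter_uniq // => w1 w2; rewrite !mem_filter.
  move=> /andP[/eqP h1 /hl[_ s1 _]] /andP[/eqP h2 /hl[_ s2 _]].
  by case: w1 w2 s1 s2 h1 h2 => [//|x1 w1] [//|x2 w2] _ _ /= -> -> ->.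
move=> u /mapP[w]; rewrite mem_filter => /andP[/eqP h /hl[Ww sw ew]] ->.
case: w sw Ww ew h => [//|x w] [sw] /words_cons[_ Ww] ew /= xs.
by split=> //; rewrite -mulgA -xs -word_eval_cons.
Qed.

End Walk.

(** The function [q ^+ norm g] is the positive function fed to Schur's test. Words of length [k]
    evaluating to [g] weigh at most [theta ^+ k], and the tail is geometric; at [n = 0] this bounds
    the Green function. *)
Lemma word_weight_decay (R : realType) (G : groupType) (mu : G -> R) :
  hyperbolic_group G -> nonelementary_group G -> admissible mu ->
  exists2 theta : R, 0 < theta < 1 & forall n g,
    (\esum_(w in [set w | [/\ words (supp mu) w, word_eval w = g & (n <= size w)%N]])
      (weight mu w)%:E <= (theta ^+ n / (1 - theta))%:E)%E.
Proof.
move=> [S [finS symS genS [delta hyp]]] ne amu.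
have [D hypD] := hyp_constE symS genS hyp.
have [F [dF F0 symF]] := symmetric_drift R symS genS finS hypD ne.
have [q [rho [/andP[q0 q1] /andP[rho0 rho1] con]]] := drift_contract R symS genS dF F0.
have [ts [uts Ets sum_mu tsV]] := admissible_enum amu.
have [_ muV _ gen] := amu.
have [|theta /andP[th0 th1] gap] := spectral_gap Ets sum_mu muV gen F0 symF
  (v := fun g => q ^+ word_norm S g) _ rho1 rho0 con.
  by move=> g; rewrite exprn_gt0.
exists theta; first by rewrite th0.
move=> n g; apply: esum_ub => l ul hl.
have decay := walk_decay Ets tsV muV th0 gap.
pose N := (\max_(w <- l) size w)%N.
have t1 : 0 < 1 - theta by rewrite subr_gt0.
have splitE : \sum_(w <- l) weight mu w =
    \sum_(n <= k < N.+1) \sum_(w <- [seq w <- l | size w == k]) weight mu w.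
  rewrite [RHS](eq_bigr (fun k => \sum_(w <- l | size w == k) weight mu w)); last first.
    by move=> k _; rewrite big_filter.
  rewrite (exchange_big_dep xpredT) //= big_seq [RHS]big_seq; apply: eq_bigr => w wl.
  rewrite -big_filter (_ : [seq k <- index_iota n N.+1 | size w == k] = [:: size w]) ?big_seq1 //.
  transitivity [seq x <- index_iota n N.+1 | x == size w].
    by apply: eq_filter => x; rewrite eq_sym.
  apply: filter_pred1_uniq; first exact: iota_uniq.
  have [_ _ h] := hl w wl.
  by rewrite mem_index_iota h ltnS leq_bigmax_seq.
rewrite splitE; apply: (@le_trans _ _ (\sum_(n <= k < N.+1) theta ^+ k)).
  apply: ler_sum => k _; apply: le_trans (decay k (g^-1)%g).
  apply: (sum_weight_le_walk uts Ets); first by rewrite filter_uniq.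
  move=> w; rewrite mem_filter => /andP[/eqP sw /hl[Ww ew _]].
  by split=> //; rewrite ew mulVg.
have geo m k : \sum_(m <= i < k) theta ^+ i <= theta ^+ m / (1 - theta).
  rewrite ler_pdivlMr // mulr_suml.
  have [km|mk] := leqP k m.
    by rewrite big_geq // exprn_ge0 // ltW.
  have -> : \sum_(m <= i < k) theta ^+ i * (1 - theta) =
      - \sum_(m <= i < k) (theta ^+ i.+1 - theta ^+ i).
    by rewrite -sumrN; apply: eq_bigr => i _; rewrite exprSr mulrBr mulr1 opprB.
  rewrite (telescope_sumr (fun i => theta ^+ i) (ltnW mk)) opprB gerBl exprn_ge0 //.
  exact: ltW.
exact: geo.
Qed.

(** * Decomposition of paths *)

Section EsumSets.
Context {R : realType} {T : choiceType}.
Implicit Types (A B : set T) (a : T -> \bar R).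

Lemma esum_subset A B a : (forall x, 0 <= a x)%E -> A `<=` B ->
  (\esum_(x in A) a x <= \esum_(x in B) a x)%E.
Proof.
move=> a0 AB; rewrite [leRHS](esumID A) // (setIidr AB) leeDl //.
by apply: esum_ge0 => x _.
Qed.

Lemma esum_setU_le A B a : (forall x, 0 <= a x)%E ->
  (\esum_(x in A `|` B) a x <= \esum_(x in A) a x + \esum_(x in B) a x)%E.
Proof.
move=> a0; rewrite (esumID A) //; apply: leeD; apply: esum_subset => // x.
by case=> -[Ax /(_ Ax)|].
Qed.

Lemma esum_mulr A a (c : R) : 0 <= c -> (forall x, 0 <= a x)%E ->
  (\esum_(x in A) (a x * c%:E) = (\esum_(x in A) a x) * c%:E)%E.
Proof.
move=> c0 a0; apply/eqP; rewrite eq_le esum_mulr_le ?lee_fin //=.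
have [->|cn] := eqVneq c 0.
  by rewrite mule0 esum_ge0 // => x _; rewrite mule0.
have cp : 0 < c by rewrite lt_neqAle eq_sym cn.
rewrite -lee_pdivlMr //.
apply: le_trans (esum_mulr_le _ _); last 2 first.
- by rewrite lee_fin invr_ge0.
- by move=> x _; rewrite mule_ge0 // lee_fin.
by apply: le_esum => x _; rewrite -muleA -EFinM divff ?mule1.
Qed.

End EsumSets.

Lemma take_size_eq_cat (T : Type) (a b a' b' : seq T) :
  a ++ b = a' ++ b' -> (size a <= size a')%N -> take (size a) a' = a.
Proof.
move=> E le; have := congr1 (take (size a)) E.
by rewrite take_size_cat // takel_cat.
Qed.

Lemma drop_size_eq_cat (T : Type) (a b a' b' : seq T) :
  a ++ b = a' ++ b' -> (size b <= size b')%N -> drop (size b' - size b) b' = b.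
Proof.
move=> E le; have := congr1 (drop (size a)) E; rewrite drop_size_cat //.
have := congr1 size E; rewrite !size_cat => sE.
by rewrite drop_cat ltnNge (_ : (size a' <= size a)%N) /=; [move=> h; rewrite [RHS]h; congr drop; lia|lia].
Qed.

Section Paths.
Variables (R : realType) (G : groupType) (mu : G -> R).
Hypothesis amu : admissible mu.
Implicit Types (x y z u v g : G) (w : seq G) (A B : set G).
Local Notation T := (supp mu).

Lemma weight_cat w1 w2 : weight mu (w1 ++ w2) = weight mu w1 * weight mu w2.
Proof. exact: big_cat. Qed.

Lemma weight_ge0 w : 0 <= weight mu w.
Proof. by apply: prodr_ge0 => s _; have [[] ] := amu. Qed.

Definition mass (X : set (seq G)) : \bar R := (\esum_(w in X) (weight mu w)%:E)%E.

Lemma weight_ge0e w : (0 <= (weight mu w)%:E)%E.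
Proof. by rewrite lee_fin weight_ge0. Qed.

Lemma massS X Y : X `<=` Y -> (mass X <= mass Y)%E.
Proof. by apply: esum_subset => w; exact: weight_ge0e. Qed.

Lemma massU X Y : (mass (X `|` Y) <= mass X + mass Y)%E.
Proof. by apply: esum_setU_le => w; exact: weight_ge0e. Qed.

Lemma Green_mass x z : Green mu (x^-1 * z)%g = mass (paths T x z).
Proof. by []. Qed.

Lemma Green_ge0 g : (0 <= Green mu g)%E.
Proof. by apply: esum_ge0 => w _; exact: weight_ge0e. Qed.

Definition vertex x w i := (x * word_eval (take i w))%g.

Lemma vertex_mid x w i j k : (i <= j <= size w)%N -> (k <= j - i)%N ->
  vertex (vertex x w i) (drop i (take j w)) k = vertex x w (i + k).
Proof.
move=> ijw kij; rewrite /vertex -mulgA -word_eval_cat; congr (_ * word_eval _)%g.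
rewrite -[in take i w](@take_takel _ i j w); last by lia.
by rewrite -takeD take_takel //; lia.
Qed.

Lemma paths_mid x w i j : words T w -> (i <= j <= size w)%N ->
  paths T (vertex x w i) (vertex x w j) (drop i (take j w)).
Proof.
move=> Ww ij; split; first by apply: words_drop; exact: words_take.
apply: (mulgI (vertex x w i)); rewrite mulVKg.
have := @vertex_mid x w i j (j - i)%N ij (leqnn _); rewrite subnKC; last by lia.
by rewrite {1}/vertex take_oversize // size_drop size_takel; lia.
Qed.

(* Cut every path of X at its first visit to A and its last visit to B: the two
   outer pieces determine the cutting points, so replacing the middle piece by
   an arbitrary path is an injective operation. *)
Lemma mass_middle x z A B (X : set (seq G)) (M : G -> G -> set (seq G)) (eta : R) :
  0 <= eta ->
  (forall u v, A u -> B v -> mass (M u v) <= Green mu (u^-1 * v)%g * eta%:E)%E ->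
  X `<=` paths T x z ->
  (forall w, X w -> exists i j, [/\ (i <= j <= size w)%N, A (vertex x w i) & B (vertex x w j)]) ->
  (forall w i j, X w -> (i <= j <= size w)%N -> A (vertex x w i) -> B (vertex x w j) ->
    M (vertex x w i) (vertex x w j) (drop i (take j w))) ->
  (mass X <= Green mu (x^-1 * z)%g * eta%:E)%E.
Proof.
move=> eta0 hM Xp Xvis Xmid.
pose st (p : seq G * seq G) := (x * word_eval p.1)%g.
pose en (p : seq G * seq G) := (z * (word_eval p.2)^-1)%g.
(* The first piece meets [A] only at its end and the second meets [B] only at its start: two
   decompositions of one word must then have pieces of equal lengths. *)
pose I := [set p : seq G * seq G |
  [/\ words T p.1, words T p.2, A (st p) /\ B (en p),
      forall k, (k < size p.1)%N -> ~ A (vertex x p.1 k) &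
      forall k, (0 < k <= size p.2)%N -> ~ B (z * (word_eval (drop k p.2))^-1)%g]].
pose e (k : (seq G * seq G) * seq G) := k.1.1 ++ k.2 ++ k.1.2.
pose c p := weight mu p.1 * weight mu p.2.
have we k : ((weight mu (e k))%:E = (weight mu k.2)%:E * (c k.1)%:E)%E.
  by rewrite /e /c !weight_cat -EFinM mulrCA !mulrA mulrC !mulrA.
have inj_e (J : seq G * seq G -> set (seq G)) : set_inj (I `*`` J) e.
  move=> [[a1 a3] a2] [[b1 b3] b2]; rewrite !inE /= => -[[_ _ [Aa Ba] mina maxa] _].
  move=> [[_ _ [Ab Bb] minb maxb] _]; rewrite /e /= => E.
  have s1 : size a1 = size b1.
    apply/eqP; rewrite eqn_leq; apply/andP; split; rewrite leqNgt; apply/negP => lt.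
      by apply: (mina _ lt); rewrite /vertex (take_size_eq_cat (esym E)) ?(ltnW lt).
    by apply: (minb _ lt); rewrite /vertex (take_size_eq_cat E) ?(ltnW lt).
  have E' := E; rewrite !catA in E'.
  have s3 : size a3 = size b3.
    apply/eqP; rewrite eqn_leq; apply/andP; split; rewrite leqNgt; apply/negP => lt.
      apply: (maxa (size a3 - size b3)%N); first by rewrite /= subn_gt0 lt leq_subr.
      by rewrite (drop_size_eq_cat (esym E')) ?(ltnW lt).
    apply: (maxb (size b3 - size a3)%N); first by rewrite /= subn_gt0 lt leq_subr.
    by rewrite (drop_size_eq_cat E') ?(ltnW lt).
  have s2 : size a2 = size b2.
    by have /eqP := congr1 size E; rewrite !size_cat s1 s3 eqn_add2l eqn_add2r => /eqP.
  move/eqP: E; rewrite eqseq_cat // => /andP[/eqP -> ].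
  by rewrite eqseq_cat // => /andP[/eqP -> /eqP ->].
have X_sub : X `<=` e @` (I `*`` (fun p => M (st p) (en p))).
  move=> w Xw; have [Ww Ew] := Xp w Xw.
  have zE : z = (x * word_eval w)%g by rewrite Ew mulVKg.
  have endE k : (z * (word_eval (drop k w))^-1)%g = vertex x w k.
    by rewrite zE -{1}(cat_take_drop k w) word_eval_cat mulgA mulgK.
  have [i0 [j0 [ij0 Ai0 Bj0]]] := Xvis w Xw.
  have exA : exists i, `[< A (vertex x w i) >] by exists i0; exact/asboolP.
  have exB : exists j, (j <= size w)%N && `[< B (vertex x w j) >].
    by exists j0; apply/andP; split; [lia|exact/asboolP].
  have bndB j : (j <= size w)%N && `[< B (vertex x w j) >] -> (j <= size w)%N.
    by case/andP.
  case: (ex_minnP exA) => i /asboolP Ai mini.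
  case: (ex_maxnP exB bndB) => j /andP[jw /asboolP Bj] maxj.
  have ii0 : (i <= i0)%N by apply: mini; exact/asboolP.
  have jj0 : (j0 <= j)%N by apply: maxj; apply/andP; split; [lia|exact/asboolP].
  have ij : (i <= j <= size w)%N by lia.
  exists ((take i w, drop j w), drop i (take j w)); last first.
    rewrite /e /= catA -[in take i w](@take_takel _ i j w); last by lia.
    by rewrite cat_take_drop cat_take_drop.
  have mid := Xmid w i j Xw ij Ai Bj.
  split=> /=; last by rewrite /st /en /= endE.
  split=> /=.
  - exact: words_take.
  - exact: words_drop.
  - by rewrite /st /en /= endE.
  - move=> k; rewrite size_takel; last by lia.
    move=> ki Ak; have := mini k; rewrite leqNgt ki => /(_ _)/negP; case=> //.
    by apply/asboolP; move: Ak; rewrite /vertex take_takel // ltnW.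
  - move=> k; rewrite size_drop drop_drop endE => kj Bk.
    have := maxj (k + j)%N; rewrite (_ : (_ <= j)%N = false); last by lia.
    by move=> h; apply: notF; apply: h; apply/andP; split; [lia|exact/asboolP].
have sub_p : e @` (I `*`` (fun p => paths T (st p) (en p))) `<=` paths T x z.
  move=> _ [[[w1 w3] w2] [/= [W1 W3 _ _ _] [W2 E2]] <-]; rewrite /e /=.
  split; first by do 2![apply/words_cat; split=> //].
  by rewrite !word_eval_cat E2 /st /en /= invgM !mulgA mulgV mul1g mulgVK.
have sumE (J : seq G * seq G -> set (seq G)) :
    mass (e @` (I `*`` J)) = (\esum_(p in I) (mass (J p) * (c p)%:E))%E.
  rewrite /mass esum_image //; under eq_esum do rewrite we.
  rewrite -(@esum_esum R _ _ I J (fun p w => (weight mu w)%:E * (c p)%:E)%E); last first.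
    by move=> *; rewrite mule_ge0 // lee_fin ?mulr_ge0 ?weight_ge0.
  apply: eq_esum => p _; rewrite esum_mulr ?mulr_ge0 ?weight_ge0 // => w.
  exact: weight_ge0e.
have c0 p : (0 <= (c p)%:E)%E by rewrite lee_fin mulr_ge0 ?weight_ge0.
(* For fixed outer pieces the weight factors, and [hM] applies to the middle piece; allowing all
   middle paths stays inside [paths T x z]. *)
apply: le_trans (massS X_sub) _; rewrite sumE.
apply: (@le_trans _ _ (\esum_(p in I) (mass (paths T (st p) (en p)) * (c p)%:E * eta%:E))%E).
  apply: le_esum => p [_ _ [Ap Bp] _ _]; rewrite -muleA (muleC (c p)%:E) muleA.
  by apply: lee_wpmul2r => //; exact: hM.
rewrite esum_mulr // => [|p]; last by rewrite mule_ge0 ?esum_ge0 // => w _; exact: weight_ge0e.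
by apply: lee_wpmul2r; rewrite ?lee_fin // -sumE; exact: massS.
Qed.

Definition visits2 x A B w :=
  exists i j, [/\ (i <= j <= size w)%N, A (vertex x w i) & B (vertex x w j)].

Definition avoiding u v A := [set w | paths T u v w /\
  forall k, (k <= size w)%N -> ~ A (vertex u w k)].

(** A visit to [A'] between the visits to [A] and [B] would give a visit to [A'] followed by one to
    [B]; so the middle piece avoids [A']. *)
Lemma mass_visits2_left x z A A' B (eta : R) : 0 <= eta ->
  (forall u v, A u -> B v ->
    mass (avoiding u v A') <= Green mu (u^-1 * v)%g * eta%:E)%E ->
  (mass [set w | [/\ paths T x z w, visits2 x A B w & ~ visits2 x A' B w]]
    <= Green mu (x^-1 * z)%g * eta%:E)%E.
Proof.
move=> eta0 h; apply: (mass_middle (M := fun u v => avoiding u v A') eta0 h).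
- by move=> w [].
- by move=> w [].
move=> w i j [[Ww _] _ nv] ij Ai Bj; split; first exact: paths_mid.
move=> k; rewrite size_drop size_takel; last by lia.
move=> kij; rewrite vertex_mid // => A'k; apply: nv.
by exists (i + k)%N, j; split=> //; lia.
Qed.

Lemma mass_visits2_right x z A B B' (eta : R) : 0 <= eta ->
  (forall u v, A u -> B v ->
    mass (avoiding u v B') <= Green mu (u^-1 * v)%g * eta%:E)%E ->
  (mass [set w | [/\ paths T x z w, visits2 x A B w & ~ visits2 x A B' w]]
    <= Green mu (x^-1 * z)%g * eta%:E)%E.
Proof.
move=> eta0 h; apply: (mass_middle (M := fun u v => avoiding u v B') eta0 h).
- by move=> w [].
- by move=> w [].
move=> w i j [[Ww _] _ nv] ij Ai Bj; split; first exact: paths_mid.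
move=> k; rewrite size_drop size_takel; last by lia.
move=> kij; rewrite vertex_mid // => B'k; apply: nv.
by exists i, (i + k)%N; split=> //; lia.
Qed.

(** A single geodesic word gives the bound, [c] being a lower bound of [mu] on its support. *)
Lemma Green_lower : exists2 c : R, 0 < c <= 1 &
  forall g, ((c ^+ word_norm T g)%:E <= Green mu g)%E.
Proof.
have [ts [_ Ets sum_mu _]] := admissible_enum amu.
have [[mu0 _] muV _ gen] := amu.
have symT : symmetric_set T by move=> s; rewrite /supp /= -muV.
have [c /andP[c0 c1] hc] : exists2 c : R, 0 < c <= 1 & forall s, s \in ts -> c <= mu s.
  have : forall s, s \in ts -> 0 < mu s by move=> s h; have : T s by rewrite Ets.
  elim: (ts) => [|t r IH] h; first by exists 1; rewrite ?ltr01 ?lexx.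
  have [|c /andP[c0 c1] hc] := IH; first by move=> s sr; apply: h; rewrite inE sr orbT.
  exists (Num.min c (mu t)).
    by rewrite lt_min c0 h ?mem_head //= ge_min c1.
  by move=> s; rewrite inE => /orP[/eqP ->|/hc sc]; rewrite ge_min ?lexx ?sc ?orbT.
exists c; first by rewrite c0.
move=> g; have [[w [Ww Ew sw]] _] := word_normP symT gen g.
apply: (@le_trans _ _ (mass [set w])).
  rewrite /mass esum_set1 ?weight_ge0e // lee_fin -sw.
  elim: w Ww {Ew sw} => [_|s w IH /words_cons[Ts Ww]]; first by rewrite /weight big_nil.
  rewrite /weight big_cons exprS ler_pM ?exprn_ge0 ?(ltW c0) ?IH // hc //.
  by move: Ts; rewrite Ets.
by apply: massS => _ ->; split.
Qed.

End Paths.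

(** * Gates along a geodesic *)

Lemma exists_expr_le (R : realType) (x y : R) : 0 < x < 1 -> 0 < y ->
  exists n, x ^+ n <= y.
Proof.
move=> /andP[x0 x1] y0; pose t := x^-1 - 1.
have xt : x * (1 + t) = 1 by rewrite addrC subrK divff // gt_eqF.
have t0 : 0 < t by rewrite subr_gt0 invf_gt1.
have b k : x ^+ k * (1 + k%:R * t) <= 1.
  elim: k => [|k IH]; first by rewrite mul0r addr0 expr0 mulr1.
  apply: le_trans IH; rewrite exprSr -mulrA ler_pM2l ?exprn_gt0 // -natr1.
  have : 0 <= k%:R * t by rewrite mulr_ge0 // ltW.
  have : x * (k%:R * t) <= k%:R * t by rewrite ler_piMl ?mulr_ge0 // ltW.
  lra.
pose n := Num.bound ((y * t)^-1); exists n.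
have nyt : 1 <= n%:R * (y * t).
  have yt0 : 0 < y * t by rewrite mulr_gt0.
  by rewrite -ler_pdivrMr // mul1r ltW // archi_boundP // invr_ge0 ltW.
have n0 : 0 < 1 + n%:R * t by rewrite ltr_wpDr // mulr_ge0 // ltW.
rewrite -(ler_pM2r n0); apply: le_trans (b n) _; lra.
Qed.

(** Writing [al] and [be] as at least powers [a] and [b] of [theta], it suffices that [a + b * r]
    stays below the exponential on the left. *)
Lemma superexp_decay (R : realType) (theta al be : R) (D : nat) :
  0 < theta < 1 -> 0 < al -> 0 < be ->
  exists n0, forall r, (n0 <= r)%N -> theta ^+ (2 ^ (r %/ D.+1)) <= al * be ^+ r.
Proof.
move=> th al0 be0; have /andP[th0 th1] := th.
have [a ha] := exists_expr_le th al0; have [b hb] := exists_expr_le th be0.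
have [t0 ht0] := leq_affine_exp2 (a + b * D.+1) (b * D.+1).
exists (t0 * D.+1)%N => r rr.
have tr : (t0 <= r %/ D.+1)%N by rewrite leq_divRL.
have := ht0 _ tr; set t := (r %/ D.+1)%N => le.
apply: (@le_trans _ _ (theta ^+ (a + b * r))).
  apply: ler_wiXn2l => //; try exact: ltW.
  apply: leq_trans le; have := ltn_ceil r (isT : (0 < D.+1)%N); rewrite -/t.
  move=> /ltnW/(leq_mul (leqnn b)); nia.
rewrite exprD exprM ler_pM ?exprn_ge0 ?(ltW th0) //.
by rewrite lerXn2r // nnegrE ?exprn_ge0 // ltW.
Qed.

Section Assembly.
Variables (R : realType) (G : groupType) (mu : G -> R) (S : set G) (D lam : nat).
Hypotheses (amu : admissible mu) (symS : symmetric_set S) (genS : generates S).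
Hypothesis hyp : hyp_const S D.
Local Notation T := (supp mu).
Local Notation d := (word_dist S).
Local Notation dT := (word_dist T).
Hypotheses (ST : forall g, (word_norm S g <= lam * word_norm T g)%N)
  (TS : forall g, (word_norm T g <= lam * word_norm S g)%N).
Implicit Types (u v x y z p g : G) (w : seq G).

Let symT : symmetric_set T.
Proof. by have [_ muV _ _] := amu; move=> s; rewrite /supp /= -muV. Qed.
Let genT : generates T.
Proof. by have [] := amu. Qed.

(** When [a] is much farther from [p] than from [u], the product of [a] and [u] at [p] is large, so
    replacing [a] by [u] costs only [D]; likewise for [b] and [v]. *)
Lemma gp2_near C a b p u v rho rho' : (gp2 S p a b <= C)%N ->
  (u = a \/ (d a u <= rho)%N /\ (rho + C + 2 * D + 1 <= d p a)%N) ->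
  (v = b \/ (d b v <= rho')%N /\ (rho' + C + 2 * D + 1 <= d p b)%N) ->
  (gp2 S p u v <= C + 2 * D)%N.
Proof.
move=> ab hu hv; have ub : (gp2 S p u b <= C + D)%N.
  case: hu => [->|[h1 h2]]; first by lia.
  by have := hyp_cases hyp p a u b; have := gp2_add symS genS p a u; lia.
case: hv => [->|[h1 h2]]; first by lia.
have := hyp_cases hyp p u v b; have := gp2_add symS genS p v b.
by rewrite (word_distC symS genS v b); lia.
Qed.

(** For a shorter word, [gp2_path] with [k = r %/ D.+1] would give [2 * r <= C + lam + k * D], where
    [k * D <= r]. *)
Lemma avoiding_size C u v p r w : avoiding mu u v [set g | (d p g <= r)%N] w ->
  (gp2 S p u v <= C)%N -> (C + lam < r)%N -> (2 ^ (r %/ D.+1) <= size w)%N.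
Proof.
move=> [[Ww Ew] far] uv Cr; rewrite leqNgt; apply/negP => /ltnW sw.
have := gp2_path symS genS hyp (p := vertex u w) (o := p) (r := r) (lam := lam) (i := 0) sw.
rewrite add0n => path; have := path _ _.
have -> : vertex u w 0 = u by rewrite /vertex take0 word_eval_nil mulg1.
have -> : vertex u w (size w) = v by rewrite /vertex take_size Ew mulVKg.
have : (r %/ D.+1 * D <= r)%N.
  by apply: leq_trans (leq_divM r D.+1); rewrite leq_mul2l leqnSn orbT.
move=> rD /(_ _ _)concl; suff : (2 * r <= gp2 S p u v + lam + r %/ D.+1 * D)%N by lia.
apply: concl => j /andP[_ js].
  by apply: ltnW; rewrite ltnNge; apply/negP; exact: far.
rewrite /vertex (take_nth 1%g js) -cats1 word_eval_cat word_eval_seq1 mulgA.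
rewrite /word_dist mulKg; apply: leq_trans (ST _) _.
rewrite -[leqRHS]muln1 leq_mul2l; apply/orP; right.
by apply: word_norm_gen => //; apply: Ww; exact: mem_nth.
Qed.

Lemma mass_avoiding_le C beta (eps : R) :
  hyperbolic_group G -> nonelementary_group G -> 0 < eps ->
  exists n0, forall r, (n0 <= r)%N -> forall u v p,
    (gp2 S p u v <= C)%N -> (dT u v <= beta * r)%N ->
    (mass mu (avoiding mu u v [set g | (d p g <= r)%N]) <=
      Green mu (u^-1 * v)%g * (eps * (1 / 2) ^+ r)%:E)%E.
Proof.
move=> hG neG eps0; have [theta th decay] := word_weight_decay hG neG amu.
have /andP[th0 th1] := th; have [c /andP[c0 c1] low] := Green_lower amu.
(* These two constants absorb the denominator of the geometric tail, the target
   [eps * (1 / 2) ^+ r], and the lower bound [c ^+ (beta * r)] of the Green function. *)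
have al0 : 0 < (1 - theta) * eps by rewrite mulr_gt0 // subr_gt0.
have be0 : 0 < c ^+ beta * (1 / 2) by rewrite mulr_gt0 ?exprn_gt0.
have [n0 hn0] := superexp_decay D th al0 be0.
exists (n0 + C + lam + 1)%N => r rr u v p uv duv.
apply: (@le_trans _ _ (theta ^+ (2 ^ (r %/ D.+1)) / (1 - theta))%:E).
  apply: le_trans (decay _ (u^-1 * v)%g); apply: massS => // w hw; have [[Ww Ew] _] := hw.
  by split=> //; apply: avoiding_size hw uv _; lia.
apply: (@le_trans _ _ ((c ^+ dT u v)%:E * (eps * (1 / 2) ^+ r)%:E)%E); last first.
  by apply: lee_wpmul2r; [rewrite lee_fin mulr_ge0 ?exprn_ge0 ?(ltW eps0)|exact: low].
rewrite -EFinM lee_fin ler_pdivrMr ?subr_gt0 //.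
apply: (le_trans (hn0 r _)); first by lia.
rewrite exprMn -exprM.
have : c ^+ (beta * r) <= c ^+ dT u v by apply: ler_wiXn2l => //; exact: ltW.
have : 0 <= (1 - theta) * eps * (1 / 2) ^+ r.
  by rewrite mulr_ge0 ?exprn_ge0 // ltW.
move: (c ^+ (beta * r)) (c ^+ dT u v) ((1 / 2) ^+ r) => a b h h0 ab.
have := ler_wpM2l h0 ab; lra.
Qed.

Definition geodesic x w := forall i j, (i <= j <= size w)%N ->
  dT (vertex x w i) (vertex x w j) = (j - i)%N.

(** Concatenate geodesic words from [x] to [y] and from [y] to [z]: the total length equals the
    distance, so no subpath can be shortened. *)
Lemma geodesic_through x y z : word_interval T x z y -> exists w m,
  [/\ (m <= size w)%N, vertex x w m = y, vertex x w (size w) = z & geodesic x w].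
Proof.
rewrite /word_interval /= => yI.
have [[w1 [W1 E1 s1]] _] := word_normP symT genT (x^-1 * y)%g.
have [[w2 [W2 E2 s2]] _] := word_normP symT genT (y^-1 * z)%g.
pose w := w1 ++ w2; have Ww : words T w by apply/words_cat.
have endE : vertex x w (size w) = z.
  by rewrite /vertex take_size word_eval_cat E1 E2 -mulgA mulVKg mulVKg.
exists w, (size w1); split=> //.
- by rewrite size_cat leq_addr.
- by rewrite /vertex take_size_cat // E1 mulVKg.
have up i j : (i <= j <= size w)%N -> (dT (vertex x w i) (vertex x w j) <= j - i)%N.
  move=> ij; have [Wm Em] := paths_mid x Ww ij.
  rewrite /word_dist -Em; apply: leq_trans (word_norm_le symT genT Wm) _.
  by rewrite size_drop size_takel //; lia.
move=> i j ij; apply/eqP; rewrite eqn_leq up //=.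
have v0 : vertex x w 0 = x by rewrite /vertex take0 word_eval_nil mulg1.
have a1 := up 0%N i ltac:(lia); have a2 := up j (size w) ltac:(lia).
have := word_distD symT genT (vertex x w i) x z.
have := word_distD symT genT (vertex x w j) (vertex x w i) z.
have sw : size w = (dT x y + dT y z)%N by rewrite size_cat s1 s2.
by move: a1 a2; rewrite v0 endE -yI -sw; lia.
Qed.

Hypothesis lam1 : (1 <= lam)%N.

Lemma geodesic_morse : exists C, forall x w, geodesic x w ->
  forall i l j, (i <= l <= j)%N -> (j <= size w)%N ->
    (gp2 S (vertex x w l) (vertex x w i) (vertex x w j) <= C)%N.
Proof.
have [C hC] := morse symS genS hyp lam1; exists C => x w geo i l j il jw.
have qg : quasi_geodesic S lam (j - i) (fun k => vertex x w (i + k)).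
  move=> a b ab; have := geo (i + a)%N (i + b)%N ltac:(lia).
  rewrite /word_dist subnDl => <-; split; [exact: ST|exact: TS].
have := hC _ _ qg (l - i)%N ltac:(lia).
by rewrite addn0 !subnKC //; lia.
Qed.

(** * Gates at doubling scales *)

Section Scales.
Variables (C n : nat) (eta : R).
Hypothesis eta0 : 0 < eta.
Hypothesis HC : forall x w, geodesic x w ->
  forall i l j, (i <= l <= j)%N -> (j <= size w)%N ->
    (gp2 S (vertex x w l) (vertex x w i) (vertex x w j) <= C)%N.
Hypothesis nC : (C + 2 * D + 1 <= n)%N.
Hypothesis Hn : forall r, (n <= r)%N -> forall u v p,
  (gp2 S p u v <= C + 2 * D)%N -> (dT u v <= 20 * lam * r)%N ->
  (mass mu (avoiding mu u v [set g | (d p g <= r)%N]) <=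
    Green mu (u^-1 * v)%g * (eta * (1 / 2) ^+ r)%:E)%E.

Variables (x : G) (w0 : seq G) (m : nat).
Hypotheses (geo : geodesic x w0) (mN : (m <= size w0)%N).
Local Notation N := (size w0).
Local Notation gam := (vertex x w0).
Let z := gam N.

Definition gate_radius k := (n * 2 ^ k)%N.
Definition gate_offset k := (lam * (4 * gate_radius k))%N.

Local Notation rad := gate_radius.
Local Notation off := gate_offset.

(* Gates around the geodesic at distance off k on either side of the vertex
   gam m; a gate that would lie beyond an endpoint is that endpoint. *)
Definition gateL k := [set u | if (m <= off k)%N then u = x else (d (gam (m - off k)) u <= rad k)%N].
Definition gateR k := [set v | if (N <= m + off k)%N then v = z else (d (gam (m + off k)) v <= rad k)%N].

Let radS k : rad k.+1 = (2 * rad k)%N.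
Proof. by rewrite /gate_radius expnS mulnCA. Qed.

Let rad_ge k : (n <= rad k)%N.
Proof. by rewrite /gate_radius leq_pmulr // expn_gt0. Qed.

Let gam0 : gam 0 = x.
Proof. by rewrite /vertex take0 word_eval_nil mulg1. Qed.

(** The gate centres have a small product at [gam l] by [HC], and [gp2_near] extends this to points
    of the gates. The gap conditions concern only gates that have not collapsed to an endpoint. *)
Lemma gate_mass ka kb l r : (n <= r)%N -> (m - off ka <= l)%N -> (l <= N)%N ->
  (l <= m + off kb)%N ->
  ((off ka < m)%N -> (lam * (rad ka + n) <= l - (m - off ka))%N) ->
  ((m + off kb < N)%N -> (lam * (rad kb + n) <= m + off kb - l)%N) ->
  (off ka + off kb + lam * (rad ka + rad kb) <= 20 * lam * r)%N ->
  forall u v, gateL ka u -> gateR kb v ->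
  (mass mu (avoiding mu u v [set g | (d (gam l) g <= r)%N]) <=
    Green mu (u^-1 * v)%g * (eta * (1 / 2) ^+ r)%:E)%E.
Proof.
move=> nr il lN lj gapL gapR tot u v Lu Rv.
pose i := (m - off ka)%N; pose j := minn N (m + off kb).
have ilj : (i <= l <= j)%N by rewrite /i /j; lia.
have jN : (j <= N)%N by rewrite /j; lia.
have dist_ge a b : (a <= b <= N)%N -> (b - a <= lam * d (gam a) (gam b))%N.
  by move=> ab; rewrite -(geo ab); exact: TS.
have cancel a b : (lam * a <= lam * b)%N -> (a <= b)%N by rewrite leq_pmul2l.
have hu : u = gam i \/ (d (gam i) u <= rad ka)%N /\
    (rad ka + C + 2 * D + 1 <= d (gam l) (gam i))%N.
  move: Lu; rewrite /gateL /=; case: leqP => [le ->|lt du].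
    by left; rewrite /i (eqP (_ : m - off ka == 0)%N) ?gam0.
  right; split=> //; rewrite (word_distC symS genS); apply: cancel.
  apply: leq_trans (dist_ge i l ltac:(lia)); apply: leq_trans (gapL lt).
  by rewrite leq_mul2l; apply/orP; right; lia.
have hv : v = gam j \/ (d (gam j) v <= rad kb)%N /\
    (rad kb + C + 2 * D + 1 <= d (gam l) (gam j))%N.
  move: Rv; rewrite /gateR /=; case: leqP => [le ->|lt dv].
    by left; rewrite /j (minn_idPl le).
  have jE : j = (m + off kb)%N by rewrite /j; lia.
  right; split; first by rewrite jE.
  apply: cancel; apply: leq_trans (dist_ge l j ltac:(lia)).
  apply: (@leq_trans (lam * (rad kb + n))).
    by rewrite leq_mul2l; apply/orP; right; lia.
  by rewrite jE; exact: gapR.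
have close a b k : b = a \/ (d a b <= k)%N /\ True -> (dT a b <= lam * k)%N.
  case=> [->|[h _]]; first by rewrite (word_distxx symT genT).
  by apply: leq_trans (TS _) _; rewrite leq_mul2l h orbT.
apply: Hn => //.
  by apply: gp2_near (HC geo ilj jN) hu hv.
have du : (dT (gam i) u <= lam * rad ka)%N by apply: close; case: hu => [|[]]; auto.
have dv : (dT (gam j) v <= lam * rad kb)%N by apply: close; case: hv => [|[]]; auto.
have ji : (j - i <= off ka + off kb)%N by rewrite /i /j; lia.
have := geo (i := i) (j := j) ltac:(lia); have := word_distD symT genT (gam i) u v.
have := word_distD symT genT (gam j) (gam i) v.
rewrite (word_distC symT genT u (gam i)); move: tot; rewrite mulnDr; lia.
Qed.

Let miss k := [set w | paths T x z w /\ ~ visits2 x (gateL k) (gateR k) w].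

Lemma mass0 (X : set (seq G)) : (forall w, ~ X w) -> (mass mu X <= 0)%E.
Proof.
move=> h; have -> : X = set0 by apply/seteqP; split=> w // /h.
by rewrite /mass esum_set0.
Qed.

(** Downward induction on the scale: from [k.+1] to [k] the left gate is replaced first ([X1] is the
    loss), then the right one ([X2]). *)
Lemma miss_le k : (mass mu (miss k) <= Green mu (x^-1 * z)%g * (2 * eta * (1 / 2) ^+ k)%:E)%E.
Proof.
have G0 := Green_ge0 amu (x^-1 * z)%g.
have bnd0 c : 0 <= c -> (0 <= Green mu (x^-1 * z)%g * (eta * c)%:E)%E.
  by move=> c0; rewrite mule_ge0 // lee_fin mulr_ge0 // ltW.
have [K] := ubnP (N - k); elim: K k => // K IH k lt.
have [Nk|kN] := leqP N k.
  (* From scale [N] on, the offset is at least the length of the geodesic, so both gates are the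
     endpoints, which every path visits. *)
  have le0 : (mass mu (miss k) <= 0)%E.
    apply: mass0 => w [[Ww Ew]]; apply.
    have big : (N <= off k)%N.
      apply: leq_trans Nk _; apply: leq_trans (ltnW (ltn_expl k (isT : 1 < 2)%N)) _.
      apply: (@leq_trans (rad k)); first by rewrite leq_pmull //; lia.
      by rewrite /gate_offset mulnA leq_pmull // muln_gt0 lam1.
    exists 0%N, (size w); split; first exact: leqnn.
      by rewrite /gateL /= (_ : (m <= off k)%N); [rewrite /vertex take0 word_eval_nil mulg1|lia].
    by rewrite /gateR /= (_ : (N <= m + off k)%N); [rewrite /vertex take_size Ew mulVKg|lia].
  apply: le_trans le0 _; rewrite -mulrA mulrCA.
  by apply: bnd0; rewrite mulr_ge0 ?exprn_ge0.
have := IH k.+1 ltac:(lia).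
set X1 := [set w | [/\ paths T x z w, visits2 x (gateL k.+1) (gateR k.+1) w &
  ~ visits2 x (gateL k) (gateR k.+1) w]].
set X2 := [set w | [/\ paths T x z w, visits2 x (gateL k) (gateR k.+1) w &
  ~ visits2 x (gateL k) (gateR k) w]].
move=> IHk; have sub : miss k `<=` miss k.+1 `|` (X1 `|` X2).
  move=> w [pw nk]; have [v1|v1] := pselect (visits2 x (gateL k.+1) (gateR k.+1) w); last by left.
  have [v2|v2] := pselect (visits2 x (gateL k) (gateR k.+1) w); last by right; left.
  by right; right.
have lamn : (lam * n <= lam * rad k)%N by rewrite leq_mul2l rad_ge orbT.
have o1 : (off k = 4 * (lam * rad k))%N by rewrite /gate_offset mulnCA.
have o2 : (off k.+1 = 8 * (lam * rad k))%N by rewrite /gate_offset radS !(mulnCA lam) mulnA.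
have l2 : (lam * rad k.+1 = 2 * (lam * rad k))%N by rewrite radS mulnCA.
have l20 : (20 * lam * rad k = 20 * (lam * rad k))%N by rewrite mulnA.
(* The worst case for the constant 20: in units of [lam * rad k], the two gates of scale [k.+1]
   contribute 8 each by their offsets and 2 each by their radii. *)
have h1 : (mass mu X1 <= Green mu (x^-1 * z)%g * (eta * (1 / 2) ^+ rad k)%:E)%E.
  have [mk|km] := leqP m (off k).
    apply: le_trans (mass0 _) (bnd0 _ (exprn_ge0 _ _)) => // w [[Ww Ew] [i [j [ij _ Bj]]]]; apply.
    exists 0%N, j; split=> //; first by lia.
    by rewrite /gateL /= mk /vertex take0 word_eval_nil mulg1.
  have A' : gateL k = [set g | (d (gam (m - off k)) g <= rad k)%N].
    by apply/seteqP; split=> g; rewrite /gateL /= (ltn_geF km).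
  apply: mass_visits2_left => //; first by rewrite mulr_ge0 ?exprn_ge0 // ltW.
  rewrite A'; apply: gate_mass; rewrite ?rad_ge // ?mulnDr; move: lamn km o1 o2 l2 l20; move: mN; clear; lia.
have h2 : (mass mu X2 <= Green mu (x^-1 * z)%g * (eta * (1 / 2) ^+ rad k)%:E)%E.
  have [mk|km] := leqP N (m + off k).
    apply: le_trans (mass0 _) (bnd0 _ (exprn_ge0 _ _)) => // w [[Ww Ew] [i [j [ij Ai _]]]]; apply.
    exists i, (size w); split=> //; first by lia.
    by rewrite /gateR /= mk /vertex take_size Ew mulVKg.
  have B' : gateR k = [set g | (d (gam (m + off k)) g <= rad k)%N].
    by apply/seteqP; split=> g; rewrite /gateR /= (ltn_geF km).
  apply: mass_visits2_right => //; first by rewrite mulr_ge0 ?exprn_ge0 // ltW.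
  rewrite B'; apply: gate_mass; rewrite ?rad_ge // ?mulnDr; move: lamn km o1 o2 l2 l20; move: mN; clear; lia.
apply: le_trans (massS amu sub) _.
apply: le_trans (massU amu _ _) _.
apply: le_trans (leeD IHk (le_trans (massU amu _ _) (leeD h1 h2))) _.
rewrite -!ge0_muleDr -?EFinD ?lee_fin ?mulr_ge0 ?addr_ge0 ?mulr_ge0 ?exprn_ge0 ?(ltW eta0) //.
apply: lee_wpmul2l => //; rewrite lee_fin exprS.
(* As [rad k] exceeds [k], the two new losses add up to at most [eta * (1 / 2) ^+ k], the same as
   the bound inherited from scale [k.+1]. *)
have : (1 / 2) ^+ rad k <= (1 / 2) ^+ k.+1 :> R.
  apply: ler_wiXn2l; rewrite ?divr_ge0 //; first by lra.
  by rewrite /gate_radius; apply: leq_trans (ltn_expl k (isT : 1 < 2)%N) _; rewrite leq_pmull //; lia.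
rewrite exprS; have := eta0; move: ((1 / 2) ^+ rad k) ((1 / 2) ^+ k) => a b e0 ab.
have : eta * a <= eta * (1 / 2 * b) by rewrite ler_pM2l.
lra.
Qed.

(** One last replacement: the left gate of scale 0 gives way to the ball around [gam m], which adds
    [eta] to the [2 * eta] of [miss_le]. *)
Lemma miss_ball_le :
  (mass mu [set w | paths T x z w /\ forall k, (k <= size w)%N -> ~ (d (gam m) (vertex x w k) <= n)%N]
    <= Green mu (x^-1 * z)%g * (3 * eta)%:E)%E.
Proof.
have G0 := Green_ge0 amu (x^-1 * z)%g.
have lamn : rad 0 = n by rewrite /gate_radius expn0 muln1.
set X1 := [set w | [/\ paths T x z w, visits2 x (gateL 0) (gateR 0) w &
  ~ visits2 x [set g | (d (gam m) g <= n)%N] (gateR 0) w]].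
have sub : [set w | paths T x z w /\ forall k, (k <= size w)%N -> ~ (d (gam m) (vertex x w k) <= n)%N]
    `<=` miss 0 `|` X1.
  move=> w [pw nv]; have [v|v] := pselect (visits2 x (gateL 0) (gateR 0) w); last by left.
  right; split=> // -[i [j [ij Ai _]]]; apply: nv Ai; lia.
have h1 : (mass mu X1 <= Green mu (x^-1 * z)%g * (eta * (1 / 2) ^+ n)%:E)%E.
  apply: mass_visits2_left => //; first by rewrite mulr_ge0 ?exprn_ge0 // ltW.
  have o1 : (off 0 = 4 * (lam * n))%N by rewrite /gate_offset lamn mulnCA.
  have l20 : (20 * lam * n = 20 * (lam * n))%N by rewrite mulnA.
  by apply: gate_mass; rewrite // ?lamn ?mulnDr; move: mN o1 l20; clear; lia.
apply: le_trans (massS amu sub) _.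
apply: le_trans (massU amu _ _) _.
apply: le_trans (leeD (miss_le 0) h1) _.
rewrite -ge0_muleDr -?EFinD ?lee_fin ?mulr_ge0 ?exprn_ge0 ?(ltW eta0) //.
apply: lee_wpmul2l => //; rewrite lee_fin expr0 mulr1.
have : (1 / 2) ^+ n <= 1 :> R by rewrite exprn_ile1 ?divr_ge0 //; lra.
have := eta0; nra.
Qed.

End Scales.
End Assembly.

(** * From missed balls to the property [TA] *)

Theorem proposition1 (R : realType) (G : groupType) (mu : G -> R)
    (hG : hyperbolic_group G) (neG : nonelementary_group G)
    (hmu : admissible mu) (epsilon : R) (eps0 : 0 < epsilon)
    (eps1 : epsilon < 1) :
  exists r : R, 0 < r /\ TA mu epsilon r.
Proof.
have [S [finS symS genS [delta hdelta]]] := hG.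
have [D hyp] := hyp_constE symS genS hdelta.
have [_ muV finT genT] := hmu.
have symT : symmetric_set (supp mu) by move=> s; rewrite /supp /= -muV.
have [l1 hl1] := word_norm_lipschitz symS genS symT genT finT.
have [l2 hl2] := word_norm_lipschitz symT genT symS genS finS.
pose lam := (l1 + l2 + 1)%N.
have lam1 : (1 <= lam)%N by rewrite /lam; lia.
have ST g : (word_norm S g <= lam * word_norm (supp mu) g)%N.
  by apply: leq_trans (hl1 g) _; rewrite leq_mul2r; apply/orP; right; rewrite /lam; lia.
have TS g : (word_norm (supp mu) g <= lam * word_norm S g)%N.
  by apply: leq_trans (hl2 g) _; rewrite leq_mul2r; apply/orP; right; rewrite /lam; lia.
have [C HC] := geodesic_morse symS genS hyp ST TS lam1.
(* The total loss [3 * eta] is then strictly below [epsilon]. *)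
have eta0 : 0 < epsilon / 4 by rewrite divr_gt0.
have [n0 Hn0] := mass_avoiding_le hmu symS genS hyp ST (C + 2 * D) (20 * lam) hG neG eta0.
pose n := (n0 + C + 2 * D + 1)%N.
have Hn r : (n <= r)%N -> forall u v p, (gp2 S p u v <= C + 2 * D)%N ->
  (word_dist (supp mu) u v <= 20 * lam * r)%N ->
  (mass mu (avoiding mu u v [set g | (word_dist S p g <= r)%N]) <=
    Green mu (u^-1 * v)%g * (epsilon / 4 * (1 / 2) ^+ r)%:E)%E.
  by move=> nr; apply: Hn0; move: nr; rewrite /n; lia.
(* The gates use balls for [S]; a ball of radius [n] for [S] lies in the ball of radius [lam * n]
   for the support of [mu]. *)
exists (lam * n)%N%:R; split; first by rewrite ltr0n muln_gt0 lam1 /n addn1.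
move=> x z y yI; have [w0 [m [mN my zE geo]]] := geodesic_through hmu yI.
have nC : (C + 2 * D + 1 <= n)%N by rewrite /n; lia.
have := miss_ball_le hmu symS genS hyp TS lam1 eta0 HC nC Hn geo mN.
rewrite zE my => miss.
set H := [set w | _].
have [theta /andP[th0 th1] decay] := word_weight_decay hG neG hmu.
have [c /andP[c0 _] low] := Green_lower hmu.
set Gr := Green mu (x^-1 * z)%g in miss *.
have Gr_pos : (0 < Gr)%E by apply: lt_le_trans (low _); rewrite lte_fin exprn_gt0.
(* Length bound 0 in the decay estimate covers all paths, so [fine] does not return its default
   value. *)
have Gr_fin : Gr \is a fin_num.
  rewrite ge0_fin_numE ?(ltW Gr_pos) //; apply: le_lt_trans (ltry (theta ^+ 0 / (1 - theta))).
  by apply: le_trans (decay 0%N (x^-1 * z)%g); apply: (massS hmu) => w [Ww Ew]; split.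
pose gr := fine Gr; have GrE : Gr = gr%:E by rewrite fineK.
have gr0 : 0 < gr by rewrite -lte_fin -GrE.
rewrite /path_prob /path_mass -/Gr -/gr.
under eq_esum do rewrite EFinM.
rewrite esum_mulr ?invr_ge0 ?(ltW gr0) //; last by move=> w; exact: weight_ge0e.
rewrite -/(mass mu _) lte_pdivlMr //.
have split_mass : (Gr = mass mu (paths (supp mu) x z `&` H) +
    mass mu (paths (supp mu) x z `&` ~` H))%E.
  by rewrite /Gr Green_mass /mass (esumID H) // => w _; exact: weight_ge0e.
have missH : (mass mu (paths (supp mu) x z `&` ~` H) <= Gr * (3 * (epsilon / 4))%:E)%E.
  apply: le_trans miss; apply: massS => // w [pw nH]; split=> // k kw yk; apply: nH.
  exists (vertex x w k); split; last by exists k.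
  rewrite /word_ball /= ler_nat; apply: leq_trans (TS _) _.
  by rewrite leq_mul2l yk orbT.
have hit_fin : mass mu (paths (supp mu) x z `&` H) \is a fin_num.
  rewrite ge0_fin_numE; last by apply: esum_ge0 => w _; exact: weight_ge0e.
  by apply: le_lt_trans (massS hmu _) (_ : Gr < +oo)%E; [move=> w []|rewrite GrE ltry].
rewrite -(fineK hit_fin); move: split_mass missH; rewrite -(fineK hit_fin) GrE.
move: (fine _) (mass mu (_ `&` ~` H)) => a [b| |] //.
move=> [E]; rewrite -!EFinM !lee_fin lte_fin /= => h; have := mulr_gt0 eps0 gr0; lra.
Qed.
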